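(* Let $n\ge1$ and suppose $\alpha,\lambda,\sigma$ are constants with $\alpha\in(0,n+2)$, $\lambda>0$, and $\sigma>G_\alpha(\lambda)$. Let $\varphi:(0,1)\to(0,\infty)$ be a continuous function with $\lim_{t\to0^+}\varphi(t)=\infty$. Then there exists a positive function $u\in C^{2,1}(\mathbb{R}^n\times(0,1))\cap L^\lambda(\mathbb{R}^n\times(0,1))$ satisfying $$0\le u_t-\Delta u\le \Big(\iint_{\mathbb{R}^n\times(0,1)}\Phi(x-y,t-s)^{\alpha/n}u(y,s)^\lambda\,dy\,ds\Big)\,u(x,t)^\sigma\quad\text{for }(x,t)\in\mathbb{R}^n\times(0,1)$$ such that $u(0,t)\ne O(\varphi(t))$ as $t\to0^+$.
   Context: $\Phi$ is the heat kernel: $\Phi(x,t)=(4\pi t)^{-n/2}e^{-|x|^2/(4t)}$ for $t>0$ and $\Phi(x,t)=0$ for $t\le0$. For $\alpha\in(0,n+2)$, $G_\alpha:(0,\infty)\to[0,\infty)$ is defined by $G_\alpha(\lambda)=\frac{2(n+2)-\alpha}{n}-\lambda$ if $0<\lambda<\frac{n+2}{n}$ and $G_\alpha(\lambda)=\max\{0,1-\frac{\alpha-2}{n+2}\lambda\}$ if $\lambda\ge\frac{n+2}{n}$. *)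

(* Defs.v *)
From HB Require Import structures.
From mathcomp Require Import all_boot all_order all_algebra.
From mathcomp Require Import all_classical all_reals all_analysis.
Set Implicit Arguments. Unset Strict Implicit. Unset Printing Implicit Defensive.
Import Order.TTheory GRing.Theory Num.Theory.
Import numFieldNormedType.Exports.
Local Open Scope classical_set_scope.
Local Open Scope ring_scope.

Section Defs.
Variable R : realType.

Definition sqnorm (n : nat) (x : 'rV[R]_n) : R := \sum_(i < n) x 0 i ^+ 2.

Definition heat_kernel (n : nat) (x : 'rV[R]_n) (t : R) : R :=
  if 0 < t then
    powR (4 * pi * t) (- (n%:R / 2)) * expR (- (sqnorm x / (4 * t)))
  else 0.

Definition G_alpha (n : nat) (alpha lambda : R) : R :=
  if lambda < (n%:R + 2) / n%:R then
    (2 * (n%:R + 2) - alpha) / n%:R - lambda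
  else Num.max 0 (1 - (alpha - 2) / (n%:R + 2) * lambda).

Definition cons_row (m : nat) (x0 : R) (y : 'rV[R]_m) : 'rV[R]_m.+1 :=
  \row_(i < m.+1) (if unlift ord0 i is Some j then y 0 j else x0).

(* integral over R^n w.r.t. Lebesgue measure of a [0,+oo]-valued function,
   computed as an iterated integral of one-dimensional Lebesgue integrals
   (equal to the integral w.r.t. n-dim Lebesgue measure for nonnegative
   measurable integrands, by Tonelli) *)
Fixpoint Rn_integral (n : nat) : ('rV[R]_n -> \bar R) -> \bar R :=
  match n with
  | 0 => fun f => f 0
  | m.+1 => fun f =>
      (\int[@lebesgue_measure R]_(x in [set: R])
          Rn_integral (fun y : 'rV[R]_m => f (cons_row x y)))%E
  end.

Definition strip_integral (n : nat) (f : 'rV[R]_n -> R -> \bar R) : \bar R :=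
  (\int[@lebesgue_measure R]_(s in `]0%R, 1%R[) Rn_integral (fun y => f y s))%E.

Definition strip (n : nat) : set ('rV[R]_n * R) :=
  [set p | 0 < p.2 < 1].

Definition evec (n : nat) (i : 'I_n) : 'rV[R]_n := delta_mx 0 i.

Definition dx (n : nat) (i : 'I_n) (u : 'rV[R]_n -> R -> R) : 'rV[R]_n -> R -> R :=
  fun x t => 'D_(evec i) (fun y => u y t) x.

Definition dt (n : nat) (u : 'rV[R]_n -> R -> R) : 'rV[R]_n -> R -> R :=
  fun x t => derive (fun s => u x s) t 1.

Definition laplacian (n : nat) (u : 'rV[R]_n -> R -> R) : 'rV[R]_n -> R -> R :=
  fun x t => \sum_(i < n) dx i (dx i u) x t.

Definition jcont (n : nat) (v : 'rV[R]_n -> R -> R) (p : 'rV[R]_n * R) : Prop :=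
  {for p, continuous (fun q : 'rV[R]_n * R => v q.1 q.2)}.

Definition C21 (n : nat) (u : 'rV[R]_n -> R -> R) : Prop :=
  forall p, @strip n p ->
    [/\ jcont u p,
        derivable (fun s => u p.1 s) p.2 1 /\ jcont (dt u) p,
        (forall i, derivable (fun y => u y p.2) p.1 (evec i) /\ jcont (dx i u) p) &
        (forall i j, derivable (fun y => dx i u y p.2) p.1 (evec j)
                     /\ jcont (dx j (dx i u)) p)].

End Defs.

(* Main.v *)
(** The solution is a sum of Gaussians [v_k], of width [r_k = r0 * kappa ^ k] and mass
    [r_k ^ (n - q)], so that [v_k] has height about [r_k ^ - q] when it appears. The bump
    [v_k] is switched on smoothly during a time [r_k ^ 2], and its heat source only acts
    during that time. When its parent [v_(k-1)] has just matured at the same place, the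
    nonlocal term produced by the parent alone is at least
    [r_(k-1) ^ (n + 2 - alpha - q lambda - q sigma)] with a wider Gaussian tail, and this
    dominates the source [r_k ^ (- q - 2)] of the child as soon as
    [q (lambda + sigma - 1) > n + 4 - alpha]. The hypothesis [sigma > G_alpha lambda] says
    that such a [q] exists below both [n] and [(n + 2) / lambda], which makes
    [sum_k v_k] converge and belong to [L^lambda].

    A chain of descendants thus gets as high as we like within a short time. We let it grow
    until it beats [phi] at its current time, then restart at a smaller scale with a bump
    born before time [0], which needs no source at all. Continuity of [phi] prevents a
    chain from growing forever, and the restarts occur at times tending to [0]. *)

Require Import Defs.
From HB Require Import structures.
From mathcomp Require Import all_boot all_order all_algebra.
From mathcomp Require Import all_classical all_reals all_analysis.
From mathcomp Require Import measurable_realfun ring lra.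
Import Order.TTheory GRing.Theory Num.Theory.
Import numFieldNormedType.Exports.
Local Open Scope classical_set_scope.
Local Open Scope ring_scope.

Set Implicit Arguments.
Unset Strict Implicit.
Unset Printing Implicit Defensive.

(** * Dominated series *)

(** The differential inequality must hold out to spatial infinity. Gaussians settle this without any
    cutoff: once switched on, a bump is an exact multiple of a heat kernel, and far away only the
    decay rates in [sqnorm x] have to be compared. The exponents are parabolic scaling: at scale
    [r], switching on a bump of height [r^-q] within time [r^2] costs [r^(-q-2)], while the kernel
    gives [r^-alpha], the window of integration [r^(n+2)], and the two powers of [u] give
    [r^(-q lambda)] and [r^(-q sigma)]. The obstacle to a single infinite chain is regularity: its
    birth times would accumulate at a positive time, near which [u] would be unbounded. Restarts
    move the accumulation to time 0, so that near a positive time all but finitely many bumps are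
    mature and controlled by their masses; every exchange of limits below rests on this. Other bumps
    never harm the estimate for one child, because the nonlocal term and [u^sigma] increase with
    [u]. A child of index [k] claims only the fraction [2^-(k+1)] of the right-hand side, so all
    sources can be added. *)

Section DominatedSeries.
Variable R : realType.
Implicit Types (f M : nat -> R).

Lemma dominated_series_cvg f M N :
  (forall k, (N <= k)%N -> `|f k| <= M k) -> cvgn (series M) ->
  cvgn (series f).
Proof.
move=> fM /cauchy_cvgP/cauchy_seriesP cM.
apply/cauchy_cvgP/cauchy_seriesP => e /cM.
case=> [[P1 P2]] /= [[n1 _ P1n] [n2 _ P2n]] sub.
exists ([set k | (N <= k)%N /\ P1 k], P2) => /=.
  split; last by exists n2.
  exists (maxn N n1) => //= k /=; rewrite geq_max => /andP[Nk nk].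
  by split => //; exact: P1n.
move=> [a b] /= [[Na P1a] P2b]; have /= := sub (a, b) (conj P1a P2b).
apply: le_lt_trans; rewrite (le_trans (ler_norm_sum _ _ _))//.
rewrite (le_trans _ (ler_norm _))//.
by apply: ler_sum_nat => k /andP[ak _]; apply: fM; exact: leq_trans ak.
Qed.

Lemma dominated_series_tail f M N (e : R) :
  (forall k, (N <= k)%N -> `|f k| <= M k) -> cvgn (series M) ->
  (forall n, (N <= n)%N -> \sum_(N <= k < n) M k <= e) ->
  `|limn (series f) - series f N| <= e.
Proof.
move=> fM cM Me; have cf := dominated_series_cvg fM cM.
have c1 : `|series f n - series f N| @[n --> \oo] -->
    `|limn (series f) - series f N|.
  by apply: cvg_norm; apply: cvgB => //; exact: cvg_cst.
rewrite -(cvg_lim _ c1)//; apply: limr_le; first by apply/cvg_ex; eexists; exact: c1.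
near=> n; have Nn : (N <= n)%N by near: n; exists N.
rewrite sub_series_geq// (le_trans (ler_norm_sum _ _ _))//.
rewrite (le_trans _ (Me n Nn))//.
by apply: ler_sum_nat => k /andP[ak _]; exact: fM.
Unshelve. all: by end_near. Qed.

Lemma summable_tail_small M (e : R) : 0 < e -> cvgn (series M) ->
  exists N0, forall N n, (N0 <= N)%N -> (N <= n)%N ->
    \sum_(N <= k < n) M k <= e.
Proof.
move=> e0 /cauchy_cvgP/cauchy_seriesP/(_ e e0).
case=> [[P1 P2]] /= [[n1 _ P1n] [n2 _ P2n]] sub.
exists (maxn n1 n2) => N n; rewrite geq_max => /andP[nN1 nN2] Nn.
have /= /ltW := sub (N, n) (conj (P1n _ nN1) (P2n _ (leq_trans nN2 Nn))).
by apply: le_trans; exact: ler_norm.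
Qed.

(** Tannery's theorem along an arbitrary filter, by splitting off a head of the series and bounding
    both tails. It serves twice: with the neighbourhoods of a point for joint continuity, and with
    [0^'] for difference quotients. Domination is asked from [N] on only, since the bumps that are
    young near the given time escape it. *)
Lemma dominated_series_lim (T : Type) (F : set_system T) (f : nat -> T -> R)
    (l M : nat -> R) (N : nat) : ProperFilter F ->
  (forall k, f k q @[q --> F] --> l k) ->
  (\forall q \near F, forall k, (N <= k)%N -> `|f k q| <= M k) ->
  cvgn (series M) ->
  limn (series (f^~ q)) @[q --> F] --> limn (series l).
Proof.
move=> FF fl fM cM.
have lM k : (N <= k)%N -> `|l k| <= M k.
  move=> Nk; have c1 : `|f k q| @[q --> F] --> `|l k| by apply: cvg_norm.
  rewrite -(cvg_lim _ c1)//; apply: limr_le; first by apply/cvg_ex; eexists; exact: c1.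
  by apply: filterS fM => q; exact.
apply/cvgrPdist_lt => e e0.
have e40 : 0 < e / 4 by rewrite divr_gt0.
have [N0 HN0] := summable_tail_small e40 cM.
pose K := maxn N N0.
have KN : (N <= K)%N by rewrite leq_maxl.
have tail n : (K <= n)%N -> \sum_(K <= k < n) M k <= e / 4.
  by move=> ?; apply: HN0 => //; rewrite leq_maxr.
have c2 : series (f^~ q) K @[q --> F] --> series l K.
  rewrite seriesEnat /=; rewrite (_ : (fun q => _) =
     \sum_(0 <= k < K) f k); last by apply/funext => q; rewrite fct_sumE.
  elim: K {KN tail} => [|K IH]; first by rewrite !big_nil; exact: cvg_cst.
  by rewrite !big_nat_recr//=; apply: cvgD.
have : \forall q \near F, `|series l K - series (f^~ q) K| < e / 4.
  by move/cvgrPdist_lt : c2; exact.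
apply: filterS2 fM => q fMq h.
have h1 : `|limn (series l) - series l K| <= e / 4.
  by apply: dominated_series_tail cM tail => k Kk; apply/lM/(leq_trans KN).
have h2 : `|limn (series (f^~ q)) - series (f^~ q) K| <= e / 4.
  by apply: dominated_series_tail cM tail => k Kk; apply/fMq/(leq_trans KN).
move: h h1 h2; rewrite !ltr_norml !ler_norml => /andP[? ?] /andP[? ?] /andP[? ?].
apply/andP; split; lra.
Qed.

(** * Termwise differentiation along a direction *)

Lemma line_is_derive (V : normedModType R) (f : V -> R) (f' : V -> R)
    (x v : V) (h : R) :
  is_derive (x + h *: v) v f (f' (x + h *: v)) ->
  is_derive h 1 (fun s => f (x + s *: v)) (f' (x + h *: v)).
Proof.
case=> df <-; have E : (fun s : R => s^-1 *: ((f \o shift (x + h *: v)) (s *: v) -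
     f (x + h *: v))) = (fun s : R => s^-1 *: (((fun s => f (x + s *: v)) \o shift h)
      (s *: 1) - f (x + h *: v))).
  apply/funext => s; rewrite /= /shift /=; congr (_ *: (f _ - _)).
  by rewrite [s *: 1]mulr1 scalerDl addrCA addrA.
by apply: DeriveDef; rewrite /derivable /derive /= -E.
Qed.

(** Restriction to the line through [x] reduces this to one variable, so that a directional
    derivative suffices, which is the notion [C21] is built on. *)
Lemma line_mean_value (V : normedModType R) (f : V -> R) (f' : V -> R)
    (x v : V) (h C : R) :
  (forall s : R, `|s| <= `|h| -> is_derive (x + s *: v) v f (f' (x + s *: v))) ->
  (forall s : R, `|s| <= `|h| -> `|f' (x + s *: v)| <= C) ->
  `|f (x + h *: v) - f x| <= C * `|h|.
Proof.
move=> df fC; pose g (s : R) := f (x + s *: v); pose g' (s : R) := f' (x + s *: v).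
have dg (s : R) : `|s| <= `|h| -> is_derive s 1 g (g' s).
  by move=> sh; apply: line_is_derive; exact: df.
have cg (a b : R) : (forall s, s \in `[a, b] -> `|s| <= `|h|) ->
    {within `[a, b], continuous g}.
  move=> ab; apply: derivable_within_continuous => s sab.
  by have [] := dg s (ab s sab).
suff [c ch E] : exists2 c : R, `|c| <= `|h| & g h - g 0 = g' c * h.
  have -> : f (x + h *: v) - f x = g h - g 0 by rewrite /g scale0r addr0.
  rewrite E normrM.
  by rewrite ler_wpM2r// fC.
have [h0|h0] := leP 0 h.
  have sub (s : R) : s \in `[0, h] -> `|s| <= `|h|.
    by rewrite in_itv/= => /andP[s0 sh]; rewrite !ger0_norm.
  have [|c ch E] := @MVT_segment _ g g' 0 h h0 _ (cg _ _ sub).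
    by move=> s /subset_itv_oo_cc/sub; exact: dg.
  by exists c; [exact: sub|rewrite E subr0].
have sub (s : R) : s \in `[h, 0] -> `|s| <= `|h|.
  by rewrite in_itv/= => /andP[sh s0]; rewrite (ltr0_norm h0) ler0_norm// lerN2.
have [|c ch E] := @MVT_segment _ g g' h 0 (ltW h0) _ (cg _ _ sub).
  by move=> s /subset_itv_oo_cc/sub; exact: dg.
exists c; first exact: sub.
by apply: oppr_inj; rewrite opprB E; ring.
Qed.

(** By the mean value inequality, the bound [M k] on the derivatives also bounds the difference
    quotients [Q k], uniformly in [h]. The limit [h -> 0] then passes through the sum by
    [dominated_series_lim]. *)
Lemma dominated_series_is_derive (V : normedModType R) (f f' : nat -> V -> R)
    (M : nat -> R) (N : nat) (x v : V) :
  (forall k y, is_derive y v (f k) (f' k y)) ->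
  (\forall y \near x, forall k, (N <= k)%N ->
     `|f k y| <= M k /\ `|f' k y| <= M k) ->
  cvgn (series M) ->
  is_derive x v (fun y => limn (series (f^~ y))) (limn (series (f'^~ x))).
Proof.
move=> df fM cM.
have nl : \forall s \near (0 : R), forall k, (N <= k)%N ->
     `|f k (x + s *: v)| <= M k /\ `|f' k (x + s *: v)| <= M k.
  have c : x + s *: v @[s --> (0 : R)] --> x.
    rewrite -[X in _ --> X]addr0; apply: cvgD; first exact: cvg_cst.
    by rewrite -[X in _ --> X](scale0r v); apply: cvgZr_tmp; exact: cvg_id.
  exact: (c _ fM).
have key : (fun h => h^-1 *: (((fun y => limn (series (f^~ y))) \o shift x) (h *: v)
    - limn (series (f^~ x)))) @ 0^' --> limn (series (f'^~ x)).
  pose Q k (h : R) := h^-1 * (f k (x + h *: v) - f k x).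
  have cQ : limn (series (Q^~ h)) @[h --> 0^'] --> limn (series (f'^~ x)).
    apply: (@dominated_series_lim _ _ Q _ M N) => //.
      move=> k; have [dk <-] := df k x.
      rewrite (_ : Q k = (fun h => h^-1 *: ((f k \o shift x) (h *: v) - f k x))) //.
      by apply/funext => h; rewrite /Q /= /shift /= [in X in f k X]addrC.
    move/nbhs_ballP : nl => [d /= d0 nl].
    exists d => //= h; rewrite /ball/= distrC subr0 => hd h0 k Nk.
    rewrite /Q normrM normfV ler_pdivrMl ?normr_gt0// mulrC.
    apply: (@line_mean_value _ (f k) (f' k)) => s sh.
    have := nl s; rewrite /ball/= distrC subr0 => /(_ (le_lt_trans sh hd) k Nk).
    by case.
  apply: cvg_trans cQ; apply: near_eq_cvg.
  near=> h; rewrite /Q /= /shift /= (addrC (h *: v)).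
  have c1 : cvgn (series (f^~ (x + h *: v))).
    apply: (@dominated_series_cvg _ M N) => // k Nk.
    have /(_ k Nk)[] // : forall k, (N <= k)%N ->
     `|f k (x + h *: v)| <= M k /\ `|f' k (x + h *: v)| <= M k.
    by near: h; apply: nbhs_dnbhs.
  have c2 : cvgn (series (f^~ x)).
    apply: (@dominated_series_cvg _ M N) => // k Nk.
    by have /(_ k Nk)[] := nbhs_singleton fM.
  rewrite -lim_seriesB// -lim_seriesZ; last exact: is_cvg_seriesB.
  by congr (limn (series _)); apply/funext => k.
apply: DeriveDef; first by apply/cvg_ex; eexists; exact: key.
by apply: cvg_lim => //; exact: key.
Unshelve. all: by end_near. Qed.

End DominatedSeries.

(** * Series of Gaussians *)

Section GaussianSeries.
Variables (R : realType) (n : nat) (A A' B B' : nat -> R -> R) (c : nat -> R).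
Hypothesis dA : forall k (t : R), is_derive t 1 (A k) (A' k t).
Hypothesis dB : forall k (t : R), is_derive t 1 (B k) (B' k t).
Hypothesis cA' : forall k, continuous (A' k).
Hypothesis cB' : forall k, continuous (B' k).
Hypothesis B_ge0 : forall k t, 0 <= B k t.
Hypothesis cvg_c : cvgn (series c).
(** Local in time and from some index on only: near a positive time all but finitely many bumps have
    matured, and their coefficients are then comparable to the summable [c k], which will be the
    masses. *)
Hypothesis dom : forall t : R, 0 < t -> exists (N : nat) (C : R), \forall s \near t,
  forall k, (N <= k)%N -> [/\ `|A k s| <= C * c k, `|A' k s| <= C * c k,
    B k s <= C & `|B' k s| <= C].

Let T := ('rV[R]_n * R)%type.

Definition gauss (k : nat) (x : 'rV[R]_n) (t : R) :=
  A k t * expR (- (B k t * sqnorm x)).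
Definition gauss_dt (k : nat) (x : 'rV[R]_n) (t : R) :=
  (A' k t - A k t * B' k t * sqnorm x) * expR (- (B k t * sqnorm x)).
Definition gauss_dx (i : 'I_n) (k : nat) (x : 'rV[R]_n) (t : R) :=
  - (2 * B k t * x 0 i) * gauss k x t.
Definition gauss_dxx (i j : 'I_n) (k : nat) (x : 'rV[R]_n) (t : R) :=
  (4 * B k t ^+ 2 * x 0 i * x 0 j - 2 * B k t * (i == j)%:R) * gauss k x t.

Definition gauss_sum (f : nat -> 'rV[R]_n -> R -> R) (x : 'rV[R]_n) (t : R) :=
  limn (series (fun k => f k x t)).

(** Reduces a directional derivative to that of an explicit function of one real variable, where the
    inference of [is_derive] instances can compute. *)
Lemma line_is_derive0 (V : normedModType R) (f : V -> R) (x v : V) (df : R) :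
  is_derive (0 : R) 1 (fun s => f (x + s *: v)) df -> is_derive x v f df.
Proof.
case=> d <-; have E : (fun s : R => s^-1 *: (((fun s => f (x + s *: v)) \o shift 0)
      (s *: 1) - f (x + 0 *: v))) = (fun s : R => s^-1 *: ((f \o shift x) (s *: v) -
     f x)).
  apply/funext => s; rewrite /= /shift /= scale0r !addr0; congr (_ *: (f _ - _)).
  by rewrite [s *: 1]mulr1 addrC.
by apply: DeriveDef; rewrite /derivable /derive -E.
Qed.

Lemma sqnorm_line (x : 'rV[R]_n) (i : 'I_n) (s : R) :
  sqnorm (x + s *: evec R i) = sqnorm x + 2 * s * x 0 i + s ^+ 2.
Proof.
rewrite /sqnorm (bigD1 i)//= [X in _ = X + _ + _](bigD1 i)//= /evec !mxE !eqxx.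
rewrite (eq_bigr (fun j => x 0 j ^+ 2)); last first.
  by move=> j ji; rewrite !mxE/= (negbTE ji) mulr0 addr0.
by rewrite /=; ring.
Qed.

Lemma coord_line (x : 'rV[R]_n) (i j : 'I_n) (s : R) :
  (x + s *: evec R j) 0 i = x 0 i + s * (i == j)%:R.
Proof. by rewrite /evec !mxE/= . Qed.

Lemma sqnorm_ge0 (m : nat) (x : 'rV[R]_m) : 0 <= sqnorm x.
Proof. by apply: sumr_ge0 => i _; exact: sqr_ge0. Qed.

Lemma gauss_is_derive_t k x (t : R) :
  is_derive t 1 (fun s => gauss k x s) (gauss_dt k x t).
Proof.
have ? := dA k t; have ? := dB k t.
rewrite /gauss; apply: is_derive_eq.
by rewrite /gauss_dt /= /GRing.scale/=; ring.
Qed.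

Lemma gauss_is_derive_x i k t x :
  is_derive x (evec R i) (fun y => gauss k y t) (gauss_dx i k x t).
Proof.
apply: line_is_derive0; rewrite /gauss.
under eq_fun do rewrite sqnorm_line.
apply: is_derive_eq.
rewrite /gauss_dx /gauss /= /GRing.scale/= .
rewrite !(mulr0,mul0r,addr0,expr0n)/=; ring.
Qed.

Lemma gauss_is_derive_xx i j k t x :
  is_derive x (evec R j) (fun y => gauss_dx i k y t) (gauss_dxx i j k x t).
Proof.
apply: line_is_derive0; rewrite /gauss_dx /gauss.
under eq_fun do rewrite sqnorm_line coord_line.
apply: is_derive_eq.
rewrite /gauss_dxx /gauss /= /GRing.scale/= .
rewrite !(mulr0,mul0r,addr0,expr0n)/=; ring.
Qed.

Lemma sqnorm_continuous (m : nat) : continuous (@sqnorm R m).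
Proof.
rewrite (_ : @sqnorm R m = \sum_(i < m) (fun x : 'rV[R]_m => x 0 i ^+ 2)); last first.
  by apply/funext => x; rewrite fct_sumE.
move=> x; apply: (big_ind (fun f : 'rV[R]_m -> R => {for x, continuous f})).
- exact: (@cst_continuous _ _ (0 : R) x).
- by move=> f g cf cg; apply: continuousD.
- move=> i _; rewrite (_ : (fun x => _) = (fun x : 'rV[R]_m => x 0 i * x 0 i)).
    by apply: continuousM; exact: coord_continuous.
  by apply/funext => y; rewrite expr2.
Qed.

Let cA k : continuous (A k).
Proof.
move=> t; apply: differentiable_continuous; apply/derivable1_diffP.
by have [] := dA k t.
Qed.

Let cB k : continuous (B k).
Proof.
move=> t; apply: differentiable_continuous; apply/derivable1_diffP.
by have [] := dB k t.
Qed.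

Lemma comp_snd_continuous (f : R -> R) : continuous f ->
  continuous (fun q : T => f q.2).
Proof.
by move=> cf q; apply: (continuous_comp (f := snd) (g := f)); [exact: cvg_snd|exact: cf].
Qed.

Lemma comp_fst_continuous (f : 'rV[R]_n -> R) : continuous f ->
  continuous (fun q : T => f q.1).
Proof.
by move=> cf q; apply: (continuous_comp (f := fst) (g := f)); [exact: cvg_fst|exact: cf].
Qed.

Let coord_cont i : continuous (fun q : T => q.1 0 i).
Proof. exact: (comp_fst_continuous (@coord_continuous R 1 n 0 i)). Qed.

Let contM (f g : T -> R) p : {for p, continuous f} -> {for p, continuous g} ->
  {for p, continuous (fun q => f q * g q)}.
Proof. exact: continuousM. Qed.

Let contB (f g : T -> R) p : {for p, continuous f} -> {for p, continuous g} ->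
  {for p, continuous (fun q => f q - g q)}.
Proof. exact: continuousB. Qed.

Let contN (f : T -> R) p : {for p, continuous f} ->
  {for p, continuous (fun q => - f q)}.
Proof. exact: continuousN. Qed.

Let expB_cont k : continuous (fun q : T => expR (- (B k q.2 * sqnorm q.1))).
Proof.
move=> q; apply: (continuous_comp (f := fun q : T => - (B k q.2 * sqnorm q.1)) (g := @expR R));
  last exact: continuous_expR.
apply: contN; apply: contM; first exact: comp_snd_continuous (@cB k) q.
exact: comp_fst_continuous (@sqnorm_continuous n) q.
Qed.

Lemma gauss_jcont k p : jcont (gauss k) p.
Proof.
apply: contM; first exact: comp_snd_continuous (@cA k) p.
exact: expB_cont.
Qed.

Lemma gauss_dt_jcont k p : jcont (gauss_dt k) p.
Proof.
apply: contM; last exact: expB_cont.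
apply: contB; first exact: comp_snd_continuous (@cA' k) p.
apply: contM; last exact: comp_fst_continuous (@sqnorm_continuous n) p.
apply: contM; first exact: comp_snd_continuous (@cA k) p.
exact: comp_snd_continuous (@cB' k) p.
Qed.

Lemma gauss_dx_jcont i k p : jcont (gauss_dx i k) p.
Proof.
apply: contM; last exact: gauss_jcont.
apply: contN; apply: contM; last exact: coord_cont.
apply: contM; first exact: cst_continuous.
exact: comp_snd_continuous (@cB k) p.
Qed.

Lemma gauss_dxx_jcont i j k p : jcont (gauss_dxx i j k) p.
Proof.
have c2 : {for p, continuous (fun q : T => B k q.2)}.
  exact: comp_snd_continuous (@cB k) p.
apply: contM; last exact: gauss_jcont.
apply: contB; last first.
  by apply: contM; [apply: contM => //|]; exact: cst_continuous.
apply: contM; last exact: coord_cont.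
apply: contM; last exact: coord_cont.
apply: contM; first exact: cst_continuous.
exact: contM.
Qed.

Lemma coord_le_sqnorm (m : nat) (x : 'rV[R]_m) (i : 'I_m) :
  `|x 0 i| <= 1 + sqnorm x.
Proof.
have : x 0 i ^+ 2 <= sqnorm x.
  by rewrite /sqnorm (bigD1 i)//= lerDl sumr_ge0// => j _; exact: sqr_ge0.
have := sqr_ge0 (`|x 0 i| - 1); rewrite sqrrB1 real_normK ?num_real//.
have := normr_ge0 (x 0 i); lra.
Qed.

(** Since [B] is nonnegative the exponential is at most 1, and the remaining factors are polynomials
    in the coordinates, bounded near [p]. A single multiple of [c] therefore dominates the function
    and all the derivatives that occur. *)
Lemma gauss_dominated (p : T) : 0 < p.2 -> exists (N : nat) (M : nat -> R),
  cvgn (series M) /\ \forall q \near p, forall k, (N <= k)%N ->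
    [/\ `|gauss k q.1 q.2| <= M k, `|gauss_dt k q.1 q.2| <= M k,
        (forall i, `|gauss_dx i k q.1 q.2| <= M k) &
        (forall i j, `|gauss_dxx i j k q.1 q.2| <= M k)].
Proof.
move=> p0; have [N [C HC]] := dom p0.
(* Near [p], [S] bounds both [sqnorm q.1] and each coordinate; [W] below adds up the bounds for the
   four kinds of prefactors. *)
pose S := 1 + (1 + sqnorm p.1).
have S1 : 1 <= S by rewrite /S; have := sqnorm_ge0 p.1; lra.
pose D := Num.max C 1.
have D1 : 1 <= D by rewrite le_max lexx orbT.
have CD : C <= D by rewrite le_max lexx.
have D0 : 0 <= D by lra.
have S0 : 0 <= S by lra.
pose W := 1 + D * S + 2 * D * S + (4 * D ^+ 2 * S * S + 2 * D).
have W0 : 0 <= W by rewrite /W !addr_ge0// !mulr_ge0// sqr_ge0.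
exists N, (fun k => (W * C) *: c k); split; first exact: is_cvg_seriesZ.
have n1 : \forall q \near p, sqnorm q.1 < 1 + sqnorm p.1.
  have c1 : {for p, continuous (fun q : T => sqnorm q.1)}.
    exact: comp_fst_continuous (@sqnorm_continuous n) p.
  move/cvgrPdist_lt : c1 => /(_ 1 ltr01).
  by apply: filterS => q; rewrite ltr_norml => /andP[? ?]; lra.
have n2 : \forall q \near p, forall k, (N <= k)%N -> [/\ `|A k q.2| <= C * c k,
    `|A' k q.2| <= C * c k, B k q.2 <= C & `|B' k q.2| <= C].
  exact: (cvg_snd (F := nbhs p.1) (G := nbhs p.2)) HC.
near=> q => k Nk.
have sq : sqnorm q.1 < 1 + sqnorm p.1 by near: q.
have [hA hA' hB hB'] : [/\ `|A k q.2| <= C * c k,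
    `|A' k q.2| <= C * c k, B k q.2 <= C & `|B' k q.2| <= C].
  by have /(_ k Nk) : forall k, (N <= k)%N -> [/\ `|A k q.2| <= C * c k,
    `|A' k q.2| <= C * c k, B k q.2 <= C & `|B' k q.2| <= C] by near: q.
have sq0 := sqnorm_ge0 q.1.
have cx i : `|q.1 0 i| <= S.
  by rewrite (le_trans (coord_le_sqnorm _ _))// lerD2l ltW.
have qS : sqnorm q.1 <= S by rewrite /S; lra.
have Cc0 : 0 <= C * c k by exact: le_trans (normr_ge0 _) hA.
have hBD : `|B k q.2| <= D by rewrite ger0_norm ?B_ge0// (le_trans hB).
have hB'D : `|B' k q.2| <= D by rewrite (le_trans hB').
have e1 : `|expR (- (B k q.2 * sqnorm q.1))| <= 1.
  rewrite ger0_norm ?expR_ge0// -expR0 ler_expR lerNl oppr0.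
  by rewrite mulr_ge0.
have g1 : `|gauss k q.1 q.2| <= C * c k.
  by rewrite normrM -[leRHS]mulr1 ler_pM.
have fin (w : R) : w <= W -> w * (C * c k) <= (W * C) *: c k.
  by move=> wW; rewrite /GRing.scale/= -mulrA ler_wpM2r.
have P1 : 0 <= D * S by rewrite mulr_ge0.
have P2 : 0 <= 2 * D * S by rewrite !mulr_ge0.
have P3 : 0 <= 4 * D ^+ 2 * S * S by rewrite !mulr_ge0// sqr_ge0.
split.
- by rewrite (le_trans g1)// -[leLHS]mul1r fin// /W; lra.
- rewrite /gauss_dt normrM -[leRHS]mulr1 ler_pM//.
  apply: (@le_trans _ _ ((1 + D * S) * (C * c k))); last by apply: fin; rewrite /W; lra.
  rewrite mulrDl mul1r (le_trans (ler_normB _ _))// lerD// !normrM.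
  rewrite -mulrA mulrC ler_pM ?mulr_ge0//.
  by rewrite ler_pM// ger0_norm.
- move=> i; rewrite /gauss_dx normrM.
  apply: (@le_trans _ _ ((2 * D * S) * (C * c k))); last by apply: fin; rewrite /W; lra.
  rewrite ler_pM// normrN !normrM ler_pM ?mulr_ge0//.
  by rewrite ger0_norm// ler_wpM2l.
- move=> i j; rewrite /gauss_dxx normrM.
  apply: (@le_trans _ _ ((4 * D ^+ 2 * S * S + 2 * D) * (C * c k))); last first.
    by apply: fin; rewrite /W; lra.
  rewrite ler_pM// (le_trans (ler_normB _ _))// lerD//.
    rewrite !normrM ler_pM ?mulr_ge0// ler_pM ?mulr_ge0//.
    by rewrite ger0_norm// expr2 ler_wpM2l// ler_pM.
  rewrite !normrM (ger0_norm (ler0n _ _)) (ger0_norm (ler0n _ _)).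
  rewrite -[leRHS]mulr1 ler_pM ?mulr_ge0//; first by rewrite ler_wpM2l.
  by case: (i == j).
Unshelve. all: by end_near. Qed.

Lemma near_fst (P : T -> Prop) (x : 'rV[R]_n) (t : R) :
  (\forall q \near (x, t), P q) -> \forall y \near x, P (y, t).
Proof.
case=> [[Q1 Q2] [/= q1 q2] sub]; apply: filterS q1 => y Q1y.
by apply: (sub (y, t)); split => //=; exact: nbhs_singleton.
Qed.

Lemma near_snd (P : T -> Prop) (x : 'rV[R]_n) (t : R) :
  (\forall q \near (x, t), P q) -> \forall s \near t, P (x, s).
Proof.
case=> [[Q1 Q2] [/= q1 q2] sub]; apply: filterS q2 => s Q2s.
by apply: (sub (x, s)); split => //=; exact: nbhs_singleton.
Qed.

Lemma gauss_sum_is_derive_t x (t : R) : 0 < t ->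
  is_derive t 1 (fun s => gauss_sum gauss x s) (gauss_sum gauss_dt x t).
Proof.
move=> t0; have [N [M [cM HM]]] := @gauss_dominated (x, t) t0.
apply: (@dominated_series_is_derive _ _ (fun k s => gauss k x s)
  (fun k s => gauss_dt k x s) M N) => //.
  by move=> k s; exact: gauss_is_derive_t.
by apply: filterS (near_snd HM) => s h k /h[].
Qed.

Lemma gauss_sum_is_derive_x i (x : 'rV[R]_n) (t : R) : 0 < t ->
  is_derive x (evec R i) (fun y => gauss_sum gauss y t)
    (gauss_sum (gauss_dx i) x t).
Proof.
move=> t0; have [N [M [cM HM]]] := @gauss_dominated (x, t) t0.
apply: (@dominated_series_is_derive _ _ (fun k y => gauss k y t)
  (fun k y => gauss_dx i k y t) M N) => //.
  by move=> k s; exact: gauss_is_derive_x.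
by apply: filterS (near_fst HM) => s h k /h[].
Qed.

Lemma gauss_sum_is_derive_xx i j (x : 'rV[R]_n) (t : R) : 0 < t ->
  is_derive x (evec R j) (fun y => gauss_sum (gauss_dx i) y t)
    (gauss_sum (gauss_dxx i j) x t).
Proof.
move=> t0; have [N [M [cM HM]]] := @gauss_dominated (x, t) t0.
apply: (@dominated_series_is_derive _ _ (fun k y => gauss_dx i k y t)
  (fun k y => gauss_dxx i j k y t) M N) => //.
  by move=> k s; exact: gauss_is_derive_xx.
by apply: filterS (near_fst HM) => s h k /h[].
Qed.

Lemma gauss_sum_cvg x t : 0 < t -> [/\ cvgn (series (fun k => gauss k x t)),
  cvgn (series (fun k => gauss_dt k x t)) &
  forall i j, cvgn (series (fun k => gauss_dxx i j k x t))].
Proof.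
move=> t0; have [N [M [cM /nbhs_singleton/= HM]]] := @gauss_dominated (x, t) t0.
by split => [||i j]; apply: dominated_series_cvg cM => k Nk; have [] := HM k Nk.
Qed.

Lemma gauss_sum_dt x t : 0 < t -> dt (gauss_sum gauss) x t = gauss_sum gauss_dt x t.
Proof. by move=> t0; have [_] := gauss_sum_is_derive_t x t0. Qed.

Lemma gauss_sum_dx i x t : 0 < t ->
  dx i (gauss_sum gauss) x t = gauss_sum (gauss_dx i) x t.
Proof. by move=> t0; have [_] := gauss_sum_is_derive_x i x t0. Qed.

Lemma gauss_sum_dxx i j x t : 0 < t ->
  dx j (dx i (gauss_sum gauss)) x t = gauss_sum (gauss_dxx i j) x t.
Proof.
move=> t0; rewrite /dx.
rewrite (_ : (fun y => _) = (fun y => gauss_sum (gauss_dx i) y t)).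
  by have [_] := gauss_sum_is_derive_xx i j x t0.
by apply/funext => y; exact: gauss_sum_dx.
Qed.

(** The termwise formulas for the derivatives hold for [t > 0] only; this is an open condition, so
    joint continuity carries over. *)
Lemma jcont_near_eq (f g : 'rV[R]_n -> R -> R) (p : T) : 0 < p.2 ->
  (forall x t, 0 < t -> f x t = g x t) -> jcont g p -> jcont f p.
Proof.
move=> p0 fg cg; rewrite /jcont /prop_for /continuous_at fg//.
apply: cvg_trans cg; apply: near_eq_cvg.
have : \forall q \near p, 0 < q.2.
  have H : \forall s \near p.2, 0 < s by exact: lt_nbhsr.
  exact: (cvg_snd (F := nbhs p.1) (G := nbhs p.2)) H.
by apply: filterS => q q0; rewrite fg.
Qed.

Lemma gauss_sum_C21 : C21 (gauss_sum gauss).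
Proof.
move=> [x t] /= /andP[t0 _]; have [N [M [cM HM]]] := @gauss_dominated (x, t) t0.
have jc (f : nat -> 'rV[R]_n -> R -> R) : (forall k, jcont (f k) (x, t)) ->
    (\forall q \near (x, t), forall k, (N <= k)%N -> `|f k q.1 q.2| <= M k) ->
    jcont (gauss_sum f) (x, t).
  by move=> cf fM; exact: (@dominated_series_lim _ _ _
    (fun k (q : T) => f k q.1 q.2) (fun k => f k x t) M N).
split.
- apply: jc => [k|]; first exact: gauss_jcont.
  by apply: filterS HM => q h k /h[].
- split; first by have [] := gauss_sum_is_derive_t x t0.
  apply: (@jcont_near_eq _ (gauss_sum gauss_dt)) => //.
    exact: gauss_sum_dt.
  apply: jc => [k|]; first exact: gauss_dt_jcont.
  by apply: filterS HM => q h k /h[].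
- move=> i; split; first by have [] := gauss_sum_is_derive_x i x t0.
  apply: (@jcont_near_eq _ (gauss_sum (gauss_dx i))) => //.
    exact: gauss_sum_dx.
  apply: jc => [k|]; first exact: gauss_dx_jcont.
  by apply: filterS HM => q h k /h[].
- move=> i j; split.
    rewrite (_ : (fun y => _) = (fun y => gauss_sum (gauss_dx i) y t)).
      by have [] := gauss_sum_is_derive_xx i j x t0.
    by apply/funext => y; exact: gauss_sum_dx.
  apply: (@jcont_near_eq _ (gauss_sum (gauss_dxx i j))) => //.
    exact: gauss_sum_dxx.
  apply: jc => [k|]; first exact: gauss_dxx_jcont.
  by apply: filterS HM => q h k /h[].
Qed.

Lemma gauss_sum_heat x t : 0 < t ->
  dt (gauss_sum gauss) x t - laplacian (gauss_sum gauss) x t =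
  limn (series (fun k => gauss_dt k x t - \sum_(i < n) gauss_dxx i i k x t)).
Proof.
move=> t0; have [_ ct cx] := gauss_sum_cvg x t0.
rewrite gauss_sum_dt// /laplacian (eq_bigr _ (fun i _ => gauss_sum_dxx i i x t0)).
have key (s : seq 'I_n) :
    cvgn (series (fun k => \sum_(i <- s) gauss_dxx i i k x t)) /\
    \sum_(i <- s) gauss_sum (gauss_dxx i i) x t =
    limn (series (fun k => \sum_(i <- s) gauss_dxx i i k x t)).
  elim: s => [|i s [IH1 IH2]].
    under eq_fun do rewrite big_nil; rewrite big_nil.
    have E : series (fun=> 0) = (fun=> 0) :> (nat -> R).
      by apply/funext => k; rewrite seriesEnat/= big1.
    by rewrite E; split; [exact: is_cvg_cst|rewrite lim_cst].
  under eq_fun do rewrite big_cons; rewrite big_cons IH2 /gauss_sum.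
  have := lim_seriesD (cx i i) IH1; have := is_cvg_seriesD (cx i i) IH1.
  by rewrite /GRing.add/= => h1 h2; split.
have [k1 k2] := key (index_enum 'I_n).
by rewrite k2 -lim_seriesB.
Qed.

End GaussianSeries.

(** * A smooth switch *)

Section Profile.
Variable R : realType.

(** The square makes the positive part continuously differentiable, and one continuous time
    derivative is all that [C21] asks of the profile. *)
Definition pos_sq (x : R) : R := Num.max 0 x ^+ 2.

Lemma pos_part_continuous : continuous (fun x : R => Num.max 0 x).
Proof.
move=> x; apply: continuous_max; [exact: cst_continuous|exact: cvg_id].
Qed.

Lemma pos_sq_is_derive (x : R) : is_derive x 1 pos_sq (2 * Num.max 0 x).
Proof.
have [x0|x0|->] := ltgtP x 0.
- apply: (@near_eq_is_derive _ _ _ (cst 0)).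
    near=> y; rewrite /pos_sq max_l ?expr0n// ltW//.
    by near: y; exact: lt_nbhsl.
  by rewrite mulr0; exact: is_derive_cst.
- apply: (@near_eq_is_derive _ _ _ (fun y : R => y ^+ 2)).
    near=> y; rewrite /pos_sq max_r// ltW//.
    by near: y; exact: lt_nbhsr.
  apply: is_derive_eq.
  by rewrite /GRing.scale/=; ring.
- rewrite mulr0.
  have key : (fun h : R => h^-1 *: ((pos_sq \o shift 0) (h *: 1) - pos_sq 0)) @ 0^'
      --> (0 : R).
    apply: (@cvg_to_0_linear _ _ 1 1) => // h /andP[h0 _].
    rewrite /= /shift/= addr0 /pos_sq maxxx expr0n/= subr0 /GRing.scale/= mulr1.
    rewrite normrM normfV ler_pdivrMl// mul1r normrX expr2 ler_pM//.
      by case: (leP 0 h) => // h'; rewrite normr0.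
    by case: (leP 0 h) => // h'; rewrite normr0.
  apply: DeriveDef; first by apply/cvg_ex; eexists; exact: key.
  by apply: cvg_lim => //; exact: key.
Unshelve. all: by end_near. Qed.

Lemma pos_sq_ge0 x : 0 <= pos_sq x. Proof. exact: sqr_ge0. Qed.

Lemma pos_sqE x : 0 <= x -> pos_sq x = x ^+ 2.
Proof. by move=> x0; rewrite /pos_sq max_r. Qed.

Lemma pos_sq0 x : x <= 0 -> pos_sq x = 0.
Proof. by move=> x0; rewrite /pos_sq max_l// expr0n. Qed.

(** A quotient of the form [f(x) / (f(x) + f(1-x))] passes from 0 to 1 on [[0, 1]] and inherits the
    regularity of [f]; the denominator never drops below 1/2, its value at the midpoint. *)
Definition ramp (x : R) : R := pos_sq x / (pos_sq x + pos_sq (1 - x)).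

Definition ramp' (x : R) : R :=
  (2 * Num.max 0 x * pos_sq (1 - x) + pos_sq x * (2 * Num.max 0 (1 - x))) /
  (pos_sq x + pos_sq (1 - x)) ^+ 2.

Lemma ramp_den_ge x : 1 / 2 <= pos_sq x + pos_sq (1 - x).
Proof.
have [x0|x0] := leP x 0.
  rewrite (pos_sq0 x0) add0r pos_sqE; last lra.
  have : 0 <= x ^+ 2 by exact: sqr_ge0.
  by rewrite (_ : (1 - x) ^+ 2 = 1 - 2 * x + x ^+ 2); [lra|ring].
have [x1|x1] := leP x 1.
  rewrite !pos_sqE; [|lra|lra].
  have : 0 <= (x - 1/2) ^+ 2 by exact: sqr_ge0.
  by rewrite (_ : (x - 1/2) ^+ 2 = (x ^+ 2 + (1 - x) ^+ 2) / 2 - 1 / 4); [lra|field].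
rewrite pos_sqE ?(ltW x0)// pos_sq0; last lra.
have : 0 <= (x - 1) ^+ 2 by exact: sqr_ge0.
by rewrite (_ : (x - 1) ^+ 2 = x ^+ 2 - 2 * x + 1); [lra|ring].
Qed.

Lemma ramp_den_gt0 x : 0 < pos_sq x + pos_sq (1 - x).
Proof. by have := ramp_den_ge x; lra. Qed.

Lemma ramp_is_derive (x : R) : is_derive x 1 ramp (ramp' x).
Proof.
have h1 := pos_sq_is_derive x.
have h2 : is_derive x 1 (fun y => pos_sq (1 - y)) (- (2 * Num.max 0 (1 - x))).
  have h3 := pos_sq_is_derive (1 - x).
  have h4 : is_derive x 1 (fun y => 1 - y) (-1).
    by apply: is_derive_eq; ring.
  have -> : - (2 * Num.max 0 (1 - x)) = 2 * Num.max 0 (1 - x) * -1 by ring.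
  exact: (@is_derive1_comp _ (@pos_sq) (fun y => 1 - y) x _ _ h3 h4).
have nz : pos_sq x + pos_sq (1 - x) != 0 by rewrite gt_eqF// ramp_den_gt0.
have h5 : is_derive x 1 (fun y => pos_sq y + pos_sq (1 - y))
    (2 * Num.max 0 x - 2 * Num.max 0 (1 - x)) by exact: is_deriveD.
have h6 := @is_deriveV _ (fun y => pos_sq y + pos_sq (1 - y)) x _ 1 nz h5.
rewrite /ramp; apply: is_derive_eq.
rewrite /ramp' /GRing.scale/=; field.
by rewrite nz.
Qed.

Lemma ramp_ge0 x : 0 <= ramp x.
Proof. by rewrite divr_ge0// ?pos_sq_ge0// ltW// ramp_den_gt0. Qed.

Lemma ramp_le1 x : ramp x <= 1.
Proof. by rewrite ler_pdivrMr ?ramp_den_gt0// mul1r lerDl pos_sq_ge0. Qed.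

Lemma ramp0 x : x <= 0 -> ramp x = 0.
Proof. by move=> x0; rewrite /ramp pos_sq0// mul0r. Qed.

Lemma ramp1 x : 1 <= x -> ramp x = 1.
Proof.
move=> x1; have := ramp_den_gt0 x; rewrite /ramp (@pos_sq0 (1 - x)) ?addr0; last lra.
by move=> h; rewrite divff// gt_eqF.
Qed.

Lemma ramp'0 x : x <= 0 -> ramp' x = 0.
Proof.
move=> x0; rewrite /ramp' (@max_l _ _ 0 x)// (@pos_sq0 x)// mulr0 !mul0r addr0.
by rewrite mul0r.
Qed.

Lemma ramp'1 x : 1 <= x -> ramp' x = 0.
Proof.
move=> x1; rewrite /ramp' (@pos_sq0 (1 - x)); last lra.
by rewrite (@max_l _ _ 0 (1 - x)) ?mulr0 ?addr0 ?mul0r//; lra.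
Qed.

Lemma ramp'_ge0 x : 0 <= ramp' x.
Proof.
by rewrite divr_ge0 ?sqr_ge0// addr_ge0// !mulr_ge0 ?pos_sq_ge0// le_max lexx.
Qed.

(** On [(0, 1)] the numerator is at most 2 + 2 and the denominator at least [(1/2)^2]. *)
Lemma ramp'_le16 x : ramp' x <= 16.
Proof.
have [x0|x0] := leP x 0; first by rewrite ramp'0.
have [x1|x1] := leP 1 x; first by rewrite ramp'1.
rewrite /ramp' ler_pdivrMr ?exprn_gt0 ?ramp_den_gt0//.
have hd : 1 / 4 <= (pos_sq x + pos_sq (1 - x)) ^+ 2.
  rewrite (_ : 1 / 4 = (1 / 2) ^+ 2); last by field.
  by rewrite ler_sqr ?nnegrE ?ramp_den_ge// ltW// ramp_den_gt0.
apply: (@le_trans _ _ 4); last lra.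
rewrite !pos_sqE; [|lra|lra].
rewrite !max_r; [|lra|lra].
have e1 : (1 - x) ^+ 2 <= 1 by rewrite expr_le1 //; lra.
have e2 : x ^+ 2 <= 1 by rewrite expr_le1 //; lra.
have e3 : 2 * x * (1 - x) ^+ 2 <= 2 * 1.
  by apply: ler_pM => //; [lra|exact: sqr_ge0|lra].
have e4 : x ^+ 2 * (2 * (1 - x)) <= 1 * 2.
  by apply: ler_pM => //; [exact: sqr_ge0|lra|lra].
lra.
Qed.

Lemma pos_sq_continuous : continuous pos_sq.
Proof.
move=> x; apply: differentiable_continuous; apply/derivable1_diffP.
by have [] := pos_sq_is_derive x.
Qed.

Lemma ramp'_continuous : continuous ramp'.
Proof.
have c1 : continuous (fun x : R => 1 - x).
  by move=> x; apply: cvgB; [exact: cvg_cst|exact: cvg_id].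
have c2 : continuous (fun x : R => pos_sq (1 - x)).
  by move=> x; apply: (continuous_comp (f := fun x : R => 1 - x) (g := pos_sq));
    [exact: c1|exact: pos_sq_continuous].
have c3 : continuous (fun x : R => Num.max 0 (1 - x)).
  by move=> x; apply: (continuous_comp (f := fun x : R => 1 - x) (g := fun x => Num.max 0 x));
    [exact: c1|exact: pos_part_continuous].
have c4 : continuous (fun x : R => pos_sq x + pos_sq (1 - x)).
  by move=> x; apply: cvgD; [exact: pos_sq_continuous|exact: c2].
move=> x; apply: cvgM.
  apply: cvgD; apply: cvgM.
  - by apply: cvgM; [exact: cvg_cst|exact: pos_part_continuous].
  - exact: c2.
  - exact: pos_sq_continuous.
  - by apply: cvgM; [exact: cvg_cst|exact: c3].
apply: cvgV; first by rewrite expf_neq0// gt_eqF// ramp_den_gt0.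
by apply: cvgM; exact: c4.
Qed.

End Profile.

(** * A single bump *)

Section Bump.
Variables (R : realType) (n : nat) (m a r : R).
Hypothesis r_gt0 : 0 < r.

Definition btime (t : R) : R := (t - a) / r ^+ 2.
(** For [t >= a] this is [t - a + r^2], the width of a heat kernel issued at time [a - r^2]. The
    quadratic term extends it to a positive, continuously differentiable function of all real times,
    so that the derivative formulas need no case distinction. *)
Definition bwidth (t : R) : R := r ^+ 2 * (1 + btime t + pos_sq (- btime t)).
Definition bwidth' (t : R) : R := 1 - 2 * Num.max 0 (- btime t).
Definition bpeak (t : R) : R := powR (4 * pi * bwidth t) (- (n%:R / 2)).
Definition bamp (t : R) : R := m * ramp (btime t) * bpeak t.
Definition bamp' (t : R) : R :=
  m * (ramp' (btime t) / r ^+ 2) * bpeak t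
  + bamp t * (- (n%:R / 2)) * (bwidth' t / bwidth t).
Definition bdecay (t : R) : R := (4 * bwidth t)^-1.
Definition bdecay' (t : R) : R := - (bwidth' t / (4 * bwidth t ^+ 2)).

Let r2_gt0 : 0 < r ^+ 2. Proof. exact: exprn_gt0. Qed.

Lemma bwidth_gt0 t : 0 < bwidth t.
Proof.
rewrite mulr_gt0//; set x := btime t.
have [x0|x0] := leP 0 x; first by have := pos_sq_ge0 (- x); lra.
rewrite pos_sqE; last lra.
have := sqr_ge0 (x + 1 / 2).
by rewrite (_ : (x + 1/2) ^+ 2 = (- x) ^+ 2 + x + 1 / 4); [lra|field].
Qed.

Lemma btime_ge0 t : a <= t -> 0 <= btime t.
Proof. by move=> at_; rewrite divr_ge0 ?subr_ge0// ltW. Qed.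

Lemma btime_ge1 t : a + r ^+ 2 <= t -> 1 <= btime t.
Proof. by move=> at_; rewrite /btime ler_pdivlMr// mul1r; lra. Qed.

Lemma btime_le0 t : t <= a -> btime t <= 0.
Proof. by move=> at_; rewrite /btime ler_pdivrMr// mul0r; lra. Qed.

Lemma bwidthE t : a <= t -> bwidth t = t - a + r ^+ 2.
Proof.
move=> at_; rewrite /bwidth pos_sq0; last by rewrite oppr_le0 btime_ge0.
by rewrite /btime; field; rewrite gt_eqF.
Qed.

Lemma bwidth'E t : a <= t -> bwidth' t = 1.
Proof.
move=> at_; rewrite /bwidth' max_l ?mulr0 ?subr0//.
by rewrite oppr_le0 btime_ge0.
Qed.

(* Hence the correction of the width before the start time, which only keeps it positive,
   leaves no trace in the heat operator. *)
Lemma ramp_bwidth' t : ramp (btime t) * bwidth' t = ramp (btime t).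
Proof.
have [at_|ta] := leP a t; first by rewrite bwidth'E// mulr1.
by rewrite ramp0 ?mul0r// btime_le0// ltW.
Qed.

Lemma bpeak_gt0 t : 0 < bpeak t.
Proof.
apply/powR_gt0/mulr_gt0; last exact: bwidth_gt0.
by apply: mulr_gt0 => //; exact: pi_gt0.
Qed.

Lemma bdecay_ge0 t : 0 <= bdecay t.
Proof. by rewrite invr_ge0 mulr_ge0// ltW// bwidth_gt0. Qed.

Lemma btime_is_derive (t : R) : is_derive t 1 btime (r ^+ 2)^-1.
Proof.
rewrite /btime; apply: is_derive_eq.
by rewrite /GRing.scale/=; ring.
Qed.

Lemma bwidth_is_derive (t : R) : is_derive t 1 bwidth (bwidth' t).
Proof.
have h1 := btime_is_derive t.
have h2 : is_derive t 1 (fun s => - btime s) (- (r ^+ 2)^-1) by exact: is_deriveN.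
have h3 := @is_derive1_comp _ (@pos_sq R) (fun s => - btime s) t _ _
  (pos_sq_is_derive _) h2.
have h4 : is_derive t 1 (fun s => pos_sq (- btime s))
   (2 * Num.max 0 (- btime t) * - (r ^+ 2)^-1) by exact: h3.
rewrite /bwidth; apply: is_derive_eq.
by rewrite /bwidth' /GRing.scale/=; field; rewrite gt_eqF.
Qed.

Lemma bpeak_is_derive (t : R) :
  is_derive t 1 bpeak (bpeak t * (- (n%:R / 2)) * (bwidth' t / bwidth t)).
Proof.
have w0 := bwidth_gt0 t; have p0 := pi_gt0 R.
have h1 := bwidth_is_derive t.
have h2 : is_derive t 1 (fun s => 4 * pi * bwidth s) (4 * pi * bwidth' t).
  by apply: is_derive_eq; rewrite /GRing.scale/=; ring.
have pos : 0 < 4 * pi * bwidth t by apply: mulr_gt0 => //; exact: mulr_gt0.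
have h3 := @is_derive1_comp _ (fun x : R => powR x (- (n%:R / 2)))
  (fun s => 4 * pi * bwidth s) t _ _ (is_derive1_powR _ pos) h2.
refine (is_derive_eq h3 _).
rewrite powRB ?powRr1 ?ltW//; last by apply/implyP => _; rewrite gt_eqF.
rewrite /bpeak; move: (powR _ _) => P; move: (bwidth' t) (bwidth t) w0 (@pi R) p0.
by move=> w' w w0 c c0; field; rewrite !gt_eqF.
Qed.

Lemma bamp_is_derive (t : R) : is_derive t 1 bamp (bamp' t).
Proof.
have h1 := bpeak_is_derive t.
have h2 : is_derive t 1 (fun s => ramp (btime s)) (ramp' (btime t) / r ^+ 2).
  exact: (@is_derive1_comp _ (@ramp R) btime t _ _ (ramp_is_derive _) (btime_is_derive t)).
rewrite /bamp; apply: is_derive_eq.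
by rewrite /bamp' /bamp /GRing.scale/=; ring.
Qed.

Lemma bdecay_is_derive (t : R) : is_derive t 1 bdecay (bdecay' t).
Proof.
have w0 := bwidth_gt0 t.
have h1 := bwidth_is_derive t.
have h2 : is_derive t 1 (fun s => 4 * bwidth s) (4 * bwidth' t).
  by apply: is_derive_eq; rewrite /GRing.scale/=; ring.
have nz : 4 * bwidth t != 0 by rewrite gt_eqF// mulr_gt0.
have h3 := @is_deriveV _ (fun s => 4 * bwidth s) t _ 1 nz h2.
refine (is_derive_eq h3 _).
by rewrite /bdecay' /GRing.scale/=; field; rewrite gt_eqF.
Qed.

Let is_derive_continuous (f f' : R -> R) :
  (forall t : R, is_derive t 1 f (f' t)) -> continuous f.
Proof.
move=> df t; apply: differentiable_continuous; apply/derivable1_diffP.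
by have [] := df t.
Qed.

Let cbtime := is_derive_continuous btime_is_derive.
Let cbwidth := is_derive_continuous bwidth_is_derive.
Let cbpeak := is_derive_continuous bpeak_is_derive.
Let cbamp := is_derive_continuous bamp_is_derive.

Let cbwidth' : continuous bwidth'.
Proof.
move=> t; apply: cvgB; first exact: cvg_cst.
apply: cvgM; first exact: cvg_cst.
apply: (continuous_comp (f := fun t : R => - btime t) (g := fun x : R => Num.max 0 x)).
  by apply: cvgN; exact: cbtime.
exact: pos_part_continuous.
Qed.

Lemma bamp'_continuous : continuous bamp'.
Proof.
move=> t; apply: cvgD.
  apply: cvgM; last exact: cbpeak.
  apply: cvgM; first exact: cvg_cst.
  apply: cvgM; last exact: cvg_cst.
  by apply: (continuous_comp (f := btime) (g := @ramp' R));
    [exact: cbtime|exact: ramp'_continuous].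
apply: cvgM; first by apply: cvgM; [exact: cbamp|exact: cvg_cst].
apply: cvgM; first exact: cbwidth'.
by apply: cvgV; [rewrite gt_eqF// bwidth_gt0|exact: cbwidth].
Qed.

Lemma bdecay'_continuous : continuous bdecay'.
Proof.
have w0 := bwidth_gt0.
move=> t; apply: cvgN; apply: cvgM; first exact: cbwidth'.
apply: cvgV; first by rewrite gt_eqF// mulr_gt0// exprn_gt0.
by apply: cvgM; [exact: cvg_cst|apply: cvgM; exact: cbwidth].
Qed.

(** The amplitude and the decay evolve as those of a heat kernel, so in the heat operator everything
    cancels except the derivative of the switch. Here [x] stands for [sqnorm] of the space
    variable. *)
Lemma bump_heat (x : R) :
  forall t, (bamp' t - bamp t * bdecay' t * x)
  - (4 * bdecay t ^+ 2 * x - 2 * n%:R * bdecay t) * bamp t =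
  m * (ramp' (btime t) / r ^+ 2) * bpeak t.
Proof.
move=> t; have w0 : bwidth t != 0 by rewrite gt_eqF// bwidth_gt0.
have E : bamp t * bwidth' t = bamp t.
  by rewrite /bamp -mulrA [_ * bwidth' t]mulrC mulrA -(mulrA m) ramp_bwidth'.
rewrite /bamp' /bdecay' /bdecay.
set S := _ * bpeak t; move: E; move: (bamp t) (bwidth' t) (bwidth t) w0 S => A w' w w0 S E.
have -> : S + A * - (n%:R / 2) * (w' / w) = S - (A * w') * (n%:R / 2) / w by field.
have -> : A * - (w' / (4 * w ^+ 2)) * x = - (A * w') / (4 * w ^+ 2) * x by field.
by rewrite E; field.
Qed.

End Bump.

(** * Iterated integrals *)

Section Integrals.
Variable R : realType.
Local Open Scope ereal_scope.
Notation mu := (@lebesgue_measure R).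

Import HBNNSimple.

(* No measurability is needed: nonnegative integrals are suprema of simple integrals. *)
Lemma integral_mono (D E : set R) (f g : R -> \bar R) :
  D `<=` E -> (forall x, E x -> 0 <= g x) ->
  (forall x, D x -> 0 <= f x <= g x) ->
  \int[mu]_(x in D) f x <= \int[mu]_(x in E) g x.
Proof.
move=> DE g0 fg; rewrite !ge0_integralE//; last by move=> x /fg/andP[].
apply: le_ereal_sup => _ [h /= hf <-]; exists h => //= x.
apply: (le_trans (hf x)); rewrite /patch.
case: ifPn => [|]; rewrite ?inE => Dx.
  by rewrite mem_set; [have /andP[] := fg x Dx|exact: DE].
by case: ifPn => //; rewrite inE => /g0.
Qed.

Lemma Rn_integral_ge0 (n : nat) (f : 'rV[R]_n -> \bar R) :
  (forall x, 0 <= f x) -> 0 <= Rn_integral f.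
Proof.
elim: n f => [|n IH] f f0 //=; apply: integral_ge0 => x _.
exact: IH.
Qed.

Lemma Rn_integral_mono (n : nat) (f g : 'rV[R]_n -> \bar R) :
  (forall x, 0 <= f x <= g x) -> Rn_integral f <= Rn_integral g.
Proof.
elim: n f g => [|n IH] f g fg /=; first by have /andP[] := fg 0%R.
apply: integral_mono => //.
  move=> x _; apply: Rn_integral_ge0 => y.
  by have /andP[] := fg (cons_row x y); exact: le_trans.
move=> x _; apply/andP; split; last by apply: IH => y; exact: fg.
by apply: Rn_integral_ge0 => y; have /andP[] := fg (cons_row x y).
Qed.

Lemma sqnorm_cons_row (n : nat) (x : R) (y : 'rV[R]_n) :
  sqnorm (cons_row x y) = (x ^+ 2 + sqnorm y)%R.
Proof.
rewrite /sqnorm big_ord_recl; congr (_ ^+ 2 + _)%R.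
  by rewrite !mxE unlift_none.
by apply: eq_bigr => i _; rewrite !mxE liftK.
Qed.

(** This is the total mass one of the normal density of variance [1/(2b)], multiplied by its
    normalising constant. *)
Lemma integral_gaussian (b : R) : (0 < b)%R ->
  \int[mu]_x (expR (- (b * x ^+ 2)))%:E = (Num.sqrt (pi / b))%:E.
Proof.
move=> b0; pose s := Num.sqrt ((2 * b)^-1)%R.
have s20 : (0 < (2 * b)^-1)%R by rewrite invr_gt0 mulr_gt0.
have s0 : (s != 0)%R by rewrite gt_eqF// sqrtr_gt0.
have s2 : (s ^+ 2 = (2 * b)^-1)%R by rewrite sqr_sqrtr// ltW.
have bn : (b != 0)%R by rewrite gt_eqF.
have p0 := normal_peak_gt0 s0.
have /= := @integral_normal_pdf R 0%R s.
rewrite normal_pdfE//; under eq_integral do rewrite EFinM.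
rewrite ge0_integralZl_EFin//; last 3 first.
- by move=> x _; rewrite lee_fin expR_ge0.
- by apply/measurable_EFinP; exact: measurable_normal_fun.
- exact: ltW.
have -> : \int[mu]_x (normal_fun 0 s x)%:E = \int[mu]_x (expR (- (b * x ^+ 2)))%:E.
  apply: eq_integral => x _; congr (_%:E); rewrite /normal_fun s2 subr0.
  by congr expR; field.
move=> E; have nE : (normal_peak s)^-1%R = Num.sqrt (pi / b)%R.
  rewrite /normal_peak invrK s2; congr Num.sqrt.
  by move: (pi : R) => p; field.
rewrite -nE -[LHS]mul1e -(mulVf (lt0r_neq0 p0)) EFinM -muleA E mule1.
by [].
Qed.

(** Fixing the first coordinate leaves a Gaussian with the same [b] and a smaller constant, hence
    the induction with [c] general. *)
Lemma Rn_integral_gaussian (n : nat) (c b : R) : (0 <= c)%R -> (0 < b)%R ->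
  Rn_integral (fun y : 'rV[R]_n => (c * expR (- (b * sqnorm y)))%:E) =
  (c * Num.sqrt (pi / b) ^+ n)%:E.
Proof.
move=> c0 b0; elim: n c c0 => [|n IH] c c0 /=.
  by rewrite /sqnorm big_ord0 mulr0 oppr0 expR0 expr0.
transitivity (\int[mu]_x ((c * Num.sqrt (pi / b) ^+ n)%:E *
    (expR (- (b * x ^+ 2)))%:E)).
  apply: eq_integral => x _.
  rewrite (_ : (fun y => _) = (fun y : 'rV[R]_n =>
    ((c * expR (- (b * x ^+ 2))) * expR (- (b * sqnorm y)))%:E)); last first.
    apply/funext => y; rewrite sqnorm_cons_row -mulrA -expRD.
    by congr ((_ * expR _)%:E); ring.
  by rewrite IH ?mulr_ge0 ?expR_ge0// mulrAC EFinM.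
rewrite ge0_integralZl_EFin//.
- by rewrite integral_gaussian// -EFinM exprSr mulrA.
- apply/measurable_EFinP; apply: (measurableT_comp (@measurable_expR R)).
  by apply: measurable_funN; apply: measurable_funM => //; exact: measurable_funX.
- by rewrite mulr_ge0// exprn_ge0// sqrtr_ge0.
Qed.

(** Monotone convergence is applied one coordinate at a time, after which the inner integral is
    again a series of explicit Gaussians; only measurability on the line is involved. *)
Lemma Rn_integral_gaussian_series (n : nat) (c b : nat -> R) :
  (forall k, 0 <= c k)%R -> (forall k, 0 < b k)%R ->
  Rn_integral (fun y : 'rV[R]_n =>
    \sum_(k <oo) (c k * expR (- (b k * sqnorm y)))%:E) =
  \sum_(k <oo) (c k * Num.sqrt (pi / b k) ^+ n)%:E.
Proof.
move=> c0 b0; elim: n c c0 => [|n IH] c c0 /=.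
  by apply: eq_eseriesr => k _; rewrite /sqnorm big_ord0 mulr0 oppr0 expR0 expr0.
transitivity (\int[mu]_x \sum_(k <oo) (c k * expR (- (b k * x ^+ 2)) *
    Num.sqrt (pi / b k) ^+ n)%:E).
  apply: eq_integral => x _.
  rewrite (_ : (fun y => _) = (fun y : 'rV[R]_n => \sum_(k <oo)
    ((c k * expR (- (b k * x ^+ 2))) * expR (- (b k * sqnorm y)))%:E)); last first.
    apply/funext => y; apply: eq_eseriesr => k _.
    rewrite sqnorm_cons_row -mulrA -expRD.
    by congr ((_ * expR _)%:E); ring.
  by rewrite IH// => k; rewrite mulr_ge0// expR_ge0.
have me k : measurable_fun setT (fun x : R => expR (- (b k * x ^+ 2))).
  apply: (measurableT_comp (@measurable_expR R)).
  by apply: measurable_funN; apply: measurable_funM => //; exact: measurable_funX.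
rewrite integral_nneseries//.
- apply: eq_eseriesr => k _; under eq_integral do rewrite mulrAC EFinM.
  rewrite ge0_integralZl_EFin//.
  + by rewrite integral_gaussian// -EFinM exprSr mulrA.
  + by apply/measurable_EFinP; exact: me.
  + by rewrite mulr_ge0// exprn_ge0// sqrtr_ge0.
- move=> k; apply/measurable_EFinP; apply: measurable_funM => //.
  by apply: measurable_funM => //; exact: me.
- move=> k x _; rewrite lee_fin !mulr_ge0 ?expR_ge0// exprn_ge0// sqrtr_ge0.
Qed.

Lemma strip_integral_lower (n : nat) (f : 'rV[R]_n -> R -> \bar R) (s1 s2 c b : R) :
  (0 <= s1)%R -> (s1 < s2)%R -> (s2 <= 1)%R -> (0 <= c)%R -> (0 < b)%R ->
  (forall y s, 0 <= f y s) ->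
  (forall y s, (s1 < s < s2)%R -> (c * expR (- (b * sqnorm y)))%:E <= f y s) ->
  ((s2 - s1) * (c * Num.sqrt (pi / b) ^+ n))%:E <= strip_integral f.
Proof.
move=> s10 s12 s21 c0 b0 f0 fc; rewrite /strip_integral.
have g0 : (0 <= c * Num.sqrt (pi / b) ^+ n)%R by rewrite mulr_ge0// exprn_ge0// sqrtr_ge0.
apply: (@le_trans _ _ (\int[mu]_(x in `]s1, s2[) (c * Num.sqrt (pi / b) ^+ n)%:E)).
  rewrite integral_cst//= lebesgue_measure_itv/= lte_fin s12 -EFinB -EFinM.
  by rewrite mulrC.
apply: integral_mono.
- move=> x /=; rewrite !in_itv/= => /andP[? ?]; apply/andP; split.
    exact: le_lt_trans s10 _.
  exact: lt_le_trans s21.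
- by move=> x _; exact: Rn_integral_ge0.
- move=> s /=; rewrite in_itv/= => sI; rewrite lee_fin g0/=.
  rewrite -Rn_integral_gaussian//; apply: Rn_integral_mono => y.
  by rewrite lee_fin mulr_ge0 ?expR_ge0//=; exact: fc.
Qed.

Lemma integral_power_shift (a d e : R) : (0 < d)%R -> (a < 1)%R -> (-1 < e)%R ->
  \int[mu]_(s in `]0%R, 1%R[) (if (a < s)%R then (s - a + d) `^ e else 0)%:E <=
  ((1 - a + d) `^ (e + 1) / (e + 1))%:E.
Proof.
move=> d0 a1 e1.
pose l := Num.max 0%R a.
have l1 : (l < 1)%R by rewrite gt_max ltr01.
have al : (a <= l)%R by rewrite le_max lexx orbT.
pose F := (fun s : R => (s - a + d) `^ (e + 1) / (e + 1))%R.
have e10 : (0 < e + 1)%R by lra.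
have pos (s : R) : (l <= s)%R -> (0 < s - a + d)%R.
  by move=> ls; have := le_trans al ls; lra.
have dF (s : R) : (l <= s)%R -> is_derive s 1%R F ((s - a + d) `^ e)%R.
  move=> ls; have h1 : is_derive s (1%R : R) (fun s => s - a + d)%R 1%R.
    by apply: is_derive_eq; ring.
  have h2 := @is_derive1_comp _ (fun x : R => x `^ (e + 1))%R (fun s => s - a + d)%R
    s _ _ (is_derive1_powR _ (pos _ ls)) h1.
  rewrite /F; have h3 : is_derive s (1%R : R) (fun s => (s - a + d) `^ (e + 1))%R
    ((e + 1) * (s - a + d) `^ (e + 1 - 1) * 1)%R by exact: h2.
  apply: is_derive_eq; rewrite /GRing.scale/= addrK; field.
  by rewrite gt_eqF.
have cF (s : R) : (l <= s)%R -> {for s, continuous F}.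
  move=> ls; apply: differentiable_continuous; apply/derivable1_diffP.
  by have [] := dF s ls.
have cf (s : R) : (l <= s)%R -> {for s, continuous (fun s : R => (s - a + d) `^ e)%R}.
  move=> ls; apply: differentiable_continuous; apply/derivable1_diffP.
  have h1 : is_derive s (1%R : R) (fun s => s - a + d)%R 1%R.
    by apply: is_derive_eq; ring.
  by have [] := @is_derive1_comp _ (fun x : R => x `^ e)%R (fun s => s - a + d)%R
    s _ _ (is_derive1_powR _ (pos _ ls)) h1.
apply: (@le_trans _ _ (\int[mu]_(s in `[l, 1%R]) ((s - a + d) `^ e)%:E)).
  rewrite integral_mkcond [leRHS]integral_mkcond; apply: integral_mono => //.
    by move=> s _; rewrite /patch; case: ifP => // _; rewrite lee_fin powR_ge0.
  move=> s _; rewrite /patch; case: ifPn => [|_]; last first.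
    by rewrite lexx/=; case: ifP => // _; rewrite lee_fin powR_ge0.
  rewrite inE/= in_itv/= => /andP[s0 s1]; case: ifPn => as_; last first.
    by rewrite lexx/=; case: ifP => // _; rewrite lee_fin powR_ge0.
  rewrite mem_set ?lee_fin ?powR_ge0//= in_itv/= (ltW s1) andbT ge_max.
  by rewrite !ltW.
rewrite (@continuous_FTC2 _ _ F)//.
- rewrite -EFinB lee_fin /F lerBlDr lerDl divr_ge0 ?powR_ge0//.
  exact: ltW.
- apply: continuous_in_subspaceT => s; rewrite inE/= in_itv/= => /andP[ls _].
  exact: cf.
- split.
  + by move=> s; rewrite in_itv/= => /andP[/ltW/dF[]].
  + by apply: cvg_at_right_filter; exact: cF.
  + by apply: cvg_at_left_filter; apply: cF; exact: ltW.
- move=> s; rewrite in_itv/= => /andP[/ltW ls _].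
  by rewrite derive1E; have [_] := dF s ls.
Qed.

End Integrals.

(** * Scales and starting times *)

Lemma powR_exprn (R : realType) (x e : R) k : 0 <= x ->
  (x ^+ k) `^ e = (x `^ e) ^+ k.
Proof. by move=> x0; rewrite -(powR_mulrn k x0) powRAC powR_mulrn ?powR_ge0. Qed.

Section Schedule.
Variables (R : realType) (n : nat) (q kappa r0 : R) (phi : R -> R).
Hypothesis kappa_gt0 : 0 < kappa.
Hypothesis kappa_half : kappa ^+ 2 <= 1 / 2.
Hypothesis r0_gt0 : 0 < r0.
Hypothesis r0_half : r0 <= 1 / 2.
Hypothesis q_gt0 : 0 < q.
Hypothesis q_ltn : q < n%:R.

Definition rad (k : nat) : R := r0 * kappa ^+ k.
Definition mass (k : nat) : R := rad k `^ (n%:R - q).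
(** The value of bump [k] at the origin at time [start k + rad k ^+ 2], when the switch has just
    reached 1 and the width is [2 * rad k ^+ 2]. *)
Definition peak (k : nat) : R :=
  mass k * powR (4 * pi * (2 * rad k ^+ 2)) (- (n%:R / 2)).

(* The start time of bump k is either just after its parent k - 1 has matured, or
   (restart) negative, so that the bump is caloric for positive times. *)
Fixpoint start (k : nat) : R :=
  if k is j.+1 then
    let t := start j + rad j ^+ 2 in
    if (0 < t) && (phi t ^+ 2 < peak j) then - rad k ^+ 2
    else start j + 2 * rad j ^+ 2
  else - rad 0 ^+ 2.

(** Comparing with the square of [phi] makes [peak j / phi] exceed the square root of [peak j],
    which is unbounded. The condition on the sign keeps the time inside the domain of [phi]; it
    fails for a bump born from a restart, which matures exactly at time 0. *)
Definition restart (j : nat) : bool :=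
  (0 < start j + rad j ^+ 2) && (phi (start j + rad j ^+ 2) ^+ 2 < peak j).

Lemma startS j : start j.+1 =
  if restart j then - rad j.+1 ^+ 2 else start j + 2 * rad j ^+ 2.
Proof. by []. Qed.

Lemma rad_gt0 k : 0 < rad k.
Proof. by rewrite mulr_gt0// exprn_gt0. Qed.

Lemma kappa_lt1 : kappa < 1.
Proof.
have [//|k1] := ltP kappa 1; have : 1 <= kappa ^+ 2 by rewrite expr_ge1// ltW.
by move: kappa_half; lra.
Qed.

Lemma radS k : rad k.+1 = kappa * rad k.
Proof. by rewrite /rad exprS mulrCA. Qed.

Lemma rad_sqS k : rad k.+1 ^+ 2 <= rad k ^+ 2 / 2.
Proof.
rewrite radS exprMn mulrC ler_wpM2l ?sqr_ge0//.
by move: kappa_half; lra.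
Qed.

Lemma rad_sq_gt0 k : 0 < rad k ^+ 2.
Proof. by rewrite exprn_gt0// rad_gt0. Qed.

Lemma rad_le j k : (j <= k)%N -> rad k <= rad j.
Proof.
move=> jk; rewrite /rad ler_pM2l//.
rewrite -(subnKC jk) exprD ler_piMr ?exprn_ge0 ?(ltW kappa_gt0)//.
by rewrite exprn_ile1 ?(ltW kappa_gt0) ?(ltW kappa_lt1).
Qed.

Lemma rad_sq_le j k : (j <= k)%N -> rad k ^+ 2 <= rad j ^+ 2.
Proof.
by move=> jk; rewrite ler_sqr ?nnegrE ?(ltW (rad_gt0 _))// rad_le.
Qed.

Lemma rad_cvg0 : rad k @[k --> \oo] --> 0.
Proof.
have -> : rad = geometric r0 kappa by [].
by apply: cvg_geometric; rewrite ger0_norm ?ltW// kappa_lt1.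
Qed.

Lemma rad_powR k x : rad k `^ x = r0 `^ x * (kappa `^ x) ^+ k.
Proof.
rewrite /rad powRM ?exprn_ge0 ?ltW//; congr (_ * _).
by rewrite powR_exprn// ltW.
Qed.

Lemma powR_lt1 (x e : R) : 0 < x -> x < 1 -> 0 < e -> x `^ e < 1.
Proof.
move=> x0 x1 e0; have := @gt0_ltr_powR _ e e0 x 1; rewrite !nnegrE powR1.
by apply => //; rewrite ltW.
Qed.

Lemma kappa_powR_norm_lt1 e : 0 < e -> `|kappa `^ e| < 1.
Proof. by move=> e0; rewrite ger0_norm ?powR_ge0// powR_lt1// kappa_lt1. Qed.

Lemma rad_powR_summable e : 0 < e -> cvgn (series (fun k => rad k `^ e)).
Proof.
move=> e0; rewrite (_ : (fun k => _) = geometric (r0 `^ e) (kappa `^ e)).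
  by apply: is_cvg_geometric_series; exact: kappa_powR_norm_lt1.
by apply/funext => k; rewrite rad_powR.
Qed.

Lemma mass_gt0 k : 0 < mass k.
Proof. by rewrite powR_gt0// rad_gt0. Qed.

Lemma sq_powR_half (x y : R) : 0 < x -> (x ^+ 2) `^ (y / 2) = x `^ y.
Proof.
move=> x0; rewrite -powR_mulrn ?ltW// -powRrM; congr (_ `^ _).
by field.
Qed.

Lemma peakE k : peak k = (8 * pi) `^ (- (n%:R / 2)) / rad k `^ q.
Proof.
have r := rad_gt0 k; have p0 := pi_gt0 R.
rewrite /peak /mass (_ : 4 * pi * (2 * rad k ^+ 2) = (8 * pi) * rad k ^+ 2); last by ring.
rewrite powRM ?sqr_ge0//; last by rewrite mulr_ge0// ltW.
rewrite -[X in (rad k ^+ 2) `^ X]mulNr sq_powR_half// mulrCA -powRD; last first.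
  by apply/implyP => _; rewrite gt_eqF.
by rewrite addrAC subrr add0r powRN.
Qed.

Lemma peak_gt0 k : 0 < peak k.
Proof.
rewrite peakE divr_gt0// ?powR_gt0 ?rad_gt0//.
by rewrite mulr_gt0// pi_gt0.
Qed.

Lemma peak_unbounded C : exists N, forall k, (N <= k)%N -> C < peak k.
Proof.
pose c : R := (8 * pi) `^ (- (n%:R / 2)).
have c0 : 0 < c by rewrite powR_gt0// mulr_gt0// pi_gt0.
have h : rad k `^ q @[k --> \oo] --> (0 : R).
  rewrite (_ : (fun k => _) = geometric (r0 `^ q) (kappa `^ q)).
    by apply: cvg_geometric; exact: kappa_powR_norm_lt1.
  by apply/funext => k; rewrite rad_powR.
have C1 : 0 < `|C| + 1 by rewrite ltr_wpDl.
move/cvgrPdist_lt : h => /(_ (c / (`|C| + 1))); rewrite divr_gt0// => /(_ isT).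
case=> N _ HN; exists N => k /HN /=; rewrite sub0r normrN.
have rk : 0 < rad k `^ q by rewrite powR_gt0// rad_gt0.
rewrite ger0_norm ?ltW// ltr_pdivlMr// => h.
rewrite peakE -/c ltr_pdivlMr//; apply: le_lt_trans h.
rewrite mulrC ler_pM2l//.
by rewrite (le_trans (ler_norm C))// lerDl.
Qed.

(** * Bounds on the starting times *)

Lemma start_ge k : - rad k ^+ 2 <= start k.
Proof.
elim: k => [|k IH]; first by [].
rewrite startS; case: ifP => // _.
by have := rad_sqS k; have := rad_sq_gt0 k; have := rad_sq_gt0 k.+1; lra.
Qed.

(** Along a chain [start k + 4 * rad k ^+ 2] does not increase: the delay [2 * rad k ^+ 2] is paid
    for by the halving of the squared radius, whence [kappa_half]. A restart at index [k] resets it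
    to [3 * rad k ^+ 2]. *)
Lemma start_le_step N k : start N = - rad N ^+ 2 -> (N <= k)%N ->
  start k + 4 * rad k ^+ 2 <= 3 * rad N ^+ 2.
Proof.
move=> sN; elim: k => [|k IH].
  by rewrite leqn0 => /eqP N0; rewrite N0 in sN *; rewrite sN; lra.
rewrite leq_eqVlt => /predU1P[<-|]; first by rewrite sN; lra.
rewrite ltnS => Nk; have {}IH := IH Nk; rewrite startS.
case: ifP => _.
  by have := @rad_sq_le N k.+1 (leqW Nk); have := rad_sq_gt0 k; lra.
by have := rad_sqS k; lra.
Qed.

Lemma start_le k : start k + 4 * rad k ^+ 2 <= 3 / 4.
Proof.
have := @start_le_step 0 k erefl (leq0n _).
have : rad 0 ^+ 2 <= (1 / 2) ^+ 2.
  by rewrite ler_sqr ?nnegrE ?(ltW (rad_gt0 _))// /rad expr0 mulr1.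
by rewrite (_ : (1 / 2) ^+ 2 = 1 / 4 :> R); [lra|field].
Qed.

Hypothesis phi_cont : {within `]0, 1[, continuous phi}.

(** Otherwise the starting times increase from some index on to a limit [L] in [(0, 1)]. The times
    of maturity tend to [L] too, so [phi] at these times stays within 1 of [phi L], while the peaks
    are unbounded: the test for a restart must succeed. *)
Lemma restart_often N : exists2 k, (N <= k)%N & restart k.
Proof.
apply: contrapT => H.
have nr k : (N <= k)%N -> ~~ restart k.
  by move=> Nk; apply/negP => rk; apply: H; exists k.
have sS k : (N <= k)%N -> start k.+1 = start k + 2 * rad k ^+ 2.
  by move=> /nr; rewrite startS => /negbTE ->.
(* The shift is by [N.+1] because [start N] may be negative, whereas [start N.+1] is at least
   [rad N ^+ 2]; this makes the limit positive. *)
pose s k := start (k + N.+1).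
have s_nd : nondecreasing_seq s.
  apply/nondecreasing_seqP => k; rewrite /s addSn sS.
    by rewrite lerDl mulr_ge0// ltW// rad_sq_gt0.
  by rewrite addnS leqW// leq_addl.
have s_ub : has_ubound (range s).
  exists (3 / 4) => _ [k _ <-]; rewrite /s.
  by have := start_le (k + N.+1); have := rad_sq_gt0 (k + N.+1); lra.
have s_cvg : cvgn s by exact: nondecreasing_is_cvgn.
pose L := limn s.
have L_ge : 0 < L.
  apply: (@lt_le_trans _ _ (s 0%N)); last exact: nondecreasing_cvgn_le.
  rewrite /s add0n sS//; have := start_ge N; have := rad_sq_gt0 N; lra.
have L_lt : L < 1.
  apply: (@le_lt_trans _ _ (3 / 4)); last lra.
  apply: limr_le => //; near=> k.
  have := start_le (k + N.+1); have := rad_sq_gt0 (k + N.+1); rewrite /s; lra.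
have t_cvg : s k + rad (k + N.+1) ^+ 2 @[k --> \oo] --> L.
  rewrite -[X in _ --> X]addr0; apply: cvgD => //.
  have -> : (0 : R) = 0 * 0 by rewrite mulr0.
  have r1 : rad (k + N.+1) @[k --> \oo] --> 0.
    by rewrite (cvg_shiftn N.+1 rad); exact: rad_cvg0.
  by under eq_fun do rewrite expr2; exact: cvgM.
have phiL : {for L, continuous phi}.
  move: phi_cont; rewrite continuous_open_subspace; last exact: interval_open.
  by apply; rewrite inE/= in_itv/= L_ge L_lt.
have phi_cvg : phi (s k + rad (k + N.+1) ^+ 2) @[k --> \oo] --> phi L.
  exact: (cvg_comp _ _ t_cvg phiL).
have [N1 HN1] := peak_unbounded ((`|phi L| + 1) ^+ 2).
move/cvgrPdist_lt : phi_cvg => /(_ 1 ltr01) [N2 _ HN2].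
pose k := maxn N1 N2.
have /HN2 /= hphi : (N2 <= k)%N by rewrite leq_maxr.
have hpk : (`|phi L| + 1) ^+ 2 < peak (k + N.+1).
  by apply: HN1; rewrite (leq_trans (leq_maxl N1 N2))// leq_addr.
have := nr (k + N.+1)%N; rewrite addnS leqW ?leq_addl// => /(_ isT).
rewrite /restart negb_and -leNgt -leNgt -addnS => /orP[h|h].
  have : 0 < s k.
    apply: (@lt_le_trans _ _ (s 0%N)); last exact: s_nd.
    rewrite /s add0n sS//; have := start_ge N; have := rad_sq_gt0 N; lra.
  by move: h; rewrite /s; have := rad_sq_gt0 (k + N.+1); lra.
have : phi (s k + rad (k + N.+1) ^+ 2) ^+ 2 <= (`|phi L| + 1) ^+ 2.
  rewrite -real_normK ?num_real// ler_sqr ?nnegrE//.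
  rewrite -lerBlDl (le_trans (lerB_dist _ _))// distrC ltW//.
by move: h hpk; rewrite /s; lra.
Unshelve. all: by end_near. Qed.

(** After a restart at index [j.+1] everything later is over by time [3 * rad j.+1 ^+ 2], and
    restarts occur at arbitrarily small radii. *)
Lemma start_cvg0 e : 0 < e ->
  exists N, forall k, (N <= k)%N -> start k + 4 * rad k ^+ 2 <= e.
Proof.
move=> e0.
have r2 : rad k ^+ 2 @[k --> \oo] --> (0 : R).
  have -> : (0 : R) = 0 * 0 by rewrite mulr0.
  by under eq_fun do rewrite expr2; apply: cvgM; exact: rad_cvg0.
have e30 : 0 < e / 3 by rewrite divr_gt0.
move/cvgrPdist_lt : r2 => /(_ _ e30) [N1 _ HN1].
have [j N1j rj] := restart_often N1.
exists j.+1 => k jk; have sj : start j.+1 = - rad j.+1 ^+ 2 by rewrite startS rj.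
rewrite (le_trans (start_le_step sj jk))//.
have := HN1 j.+1 (leqW N1j); rewrite /= sub0r normrN.
by rewrite ger0_norm ?sqr_ge0//; lra.
Qed.

End Schedule.

(** * Pointwise estimates *)

Section Estimates.
Variable R : realType.
Implicit Types (r q s x y e : R).

Lemma powRN_anti x y e : 0 < x -> x <= y -> 0 <= e -> y `^ (- e) <= x `^ (- e).
Proof.
move=> x0 xy e0; have y0 := lt_le_trans x0 xy.
rewrite !powRN lef_pV2 ?posrE ?powR_gt0//.
by apply: ge0_ler_powR => //; rewrite nnegrE ltW.
Qed.

Lemma powR_scaled_sq (n : nat) (c r : R) : 0 < c -> 0 < r ->
  (c * r ^+ 2) `^ (- (n%:R / 2)) = c `^ (- (n%:R / 2)) * r `^ (- n%:R).
Proof.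
move=> c0 r0; rewrite powRM ?sqr_ge0 ?(ltW c0)//.
by rewrite -[X in (r ^+ 2) `^ X]mulNr sq_powR_half.
Qed.

Lemma powR_mass (n : nat) r q : 0 < r -> r `^ (n%:R - q) * r `^ (- n%:R) = r `^ (- q).
Proof.
move=> r0; rewrite -powRD; last by apply/implyP => _; rewrite gt_eqF.
by congr (_ `^ _); ring.
Qed.

Lemma powR_expR x e : expR x `^ e = expR (e * x).
Proof. by rewrite /powR gt_eqF ?expR_gt0// expRK. Qed.

(** In this phase the width lies between [2 r^2] and [4 r^2]. The upper bound enters the amplitude
    as [16 pi r^2], the lower bound enters the exponent as [8 r^2]. *)
Lemma bump_lower (n : nat) q (a r : R) (y : 'rV[R]_n) s :
  0 < r -> a + r ^+ 2 <= s <= a + 3 * r ^+ 2 ->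
  (16 * pi) `^ (- (n%:R / 2)) * r `^ (- q) * expR (- (sqnorm y / (8 * r ^+ 2))) <=
  bamp n (r `^ (n%:R - q)) a r s * expR (- (bdecay a r s * sqnorm y)).
Proof.
move=> r0 /andP[s1 s2]; have r2 : 0 < r ^+ 2 by rewrite exprn_gt0.
have p0 := pi_gt0 R.
have as_ : a <= s by lra.
have w := bwidthE r0 as_; have w0 := bwidth_gt0 a r0 s.
rewrite /bamp (ramp1 (btime_ge1 r0 s1)) mulr1; apply: ler_pM.
- by rewrite mulr_ge0// powR_ge0.
- exact: expR_ge0.
- rewrite -(powR_mass n q r0) mulrCA ler_wpM2l ?powR_ge0//.
  rewrite -powR_scaled_sq//; last exact: mulr_gt0.
  rewrite /bpeak; apply: powRN_anti; last by rewrite divr_ge0.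
  + by apply: mulr_gt0 => //; exact: mulr_gt0.
  + rewrite w (_ : 16 * pi * r ^+ 2 = 4 * pi * (4 * r ^+ 2)); last by ring.
    by rewrite ler_pM2l; [lra|exact: mulr_gt0].
- rewrite ler_expR lerN2 /bdecay mulrC ler_wpM2l ?sqnorm_ge0//.
  by rewrite lef_pV2 ?posrE; [rewrite w; lra|lra|lra].
Qed.

Lemma sqnormB_le (n : nat) (x y : 'rV[R]_n) :
  sqnorm (x - y) <= 2 * (sqnorm x + sqnorm y).
Proof.
rewrite /sqnorm -big_split mulr_sumr/=; apply: ler_sum => i _; rewrite !mxE.
have := sqr_ge0 (x 0 i + y 0 i); rewrite sqrrD sqrrB; lra.
Qed.

(** The prefactor uses [s <= 2 r^2] and the exponent [s >= r^2 / 2]. Bounding [sqnorm (x - y)] by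
    twice the sum decouples [x] from [y], so that the integral over [y] becomes an exact Gaussian
    one. *)
Lemma heat_kernel_lower (n : nat) r (x y : 'rV[R]_n) s :
  0 < r -> r ^+ 2 / 2 <= s <= 2 * r ^+ 2 ->
  (8 * pi) `^ (- (n%:R / 2)) * r `^ (- n%:R) *
    expR (- ((sqnorm x + sqnorm y) / r ^+ 2)) <= heat_kernel (x - y) s.
Proof.
move=> r0 /andP[s1 s2]; have r2 : 0 < r ^+ 2 by rewrite exprn_gt0.
have p0 := pi_gt0 R; have s0 : 0 < s by lra.
rewrite /heat_kernel s0; apply: ler_pM.
- by rewrite mulr_ge0// powR_ge0.
- exact: expR_ge0.
- rewrite -powR_scaled_sq//; last exact: mulr_gt0.
  apply: powRN_anti; last by rewrite divr_ge0.
  + by apply: mulr_gt0 => //; exact: mulr_gt0.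
  + rewrite (_ : 8 * pi * r ^+ 2 = 4 * pi * (2 * r ^+ 2)); last by ring.
    by rewrite ler_pM2l//; exact: mulr_gt0.
- rewrite ler_expR lerN2 ler_pdivrMr; last exact: mulr_gt0.
  apply: (le_trans (sqnormB_le x y)).
  have X0 : 0 <= sqnorm x + sqnorm y by rewrite addr_ge0// sqnorm_ge0.
  rewrite mulrC -[leRHS]mulrA ler_wpM2l// [leRHS]mulrC ler_pdivlMr//; lra.
Qed.

(** The source lives on the switching interval, where the width is between [r^2] and [2 r^2]: the
    first bound controls the amplitude, the second the decay. The factor 16 bounds [ramp'], and [x]
    stands for a squared norm. *)
Lemma bump_source_upper (n : nat) q (a r : R) (x : R) t :
  0 < r -> 0 <= x ->
  r `^ (n%:R - q) * (ramp' (btime a r t) / r ^+ 2) * bpeak n a r t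
    * expR (- (bdecay a r t * x)) <=
  16 * r `^ (- q - 2) * expR (- (x / (8 * r ^+ 2))).
Proof.
move=> r0 x0; have r2 : 0 < r ^+ 2 by rewrite exprn_gt0.
have rhs0 : 0 <= 16 * r `^ (- q - 2) * expR (- (x / (8 * r ^+ 2))).
  by rewrite mulr_ge0 ?expR_ge0// mulr_ge0// powR_ge0.
have [ta|at_] := leP t a.
  by rewrite ramp'0 ?mul0r ?mulr0 ?mul0r// btime_le0.
have [ta2|ta2] := leP (a + r ^+ 2) t.
  by rewrite ramp'1 ?mul0r ?mulr0 ?mul0r// btime_ge1.
have w := bwidthE r0 (ltW at_); have w0 := bwidth_gt0 a r0 t.
have bp : 0 <= bpeak n a r t by apply/ltW/bpeak_gt0.
have rp : 0 <= ramp' (btime a r t) / r ^+ 2 by rewrite divr_ge0 ?ramp'_ge0// ltW.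
apply: ler_pM.
- by apply: mulr_ge0; [apply: mulr_ge0; [exact: powR_ge0|exact: rp]|exact: bp].
- exact: expR_ge0.
- have -> : r `^ (- q - 2) = r `^ (n%:R - q) * (r ^+ 2)^-1 * r `^ (- n%:R).
    rewrite mulrAC powR_mass// powRB; last by apply/implyP => _; rewrite gt_eqF.
    by rewrite powR_mulrn// ltW.
  rewrite [leRHS]mulrA; apply: ler_pM.
  + by apply: mulr_ge0; [exact: powR_ge0|exact: rp].
  + exact: bp.
  + rewrite [leRHS]mulrCA ler_wpM2l ?powR_ge0//.
    by rewrite ler_wpM2r ?invr_ge0 ?(ltW r2)// ramp'_le16.
  + have -> : r `^ (- n%:R) = (r ^+ 2) `^ (- (n%:R / 2)).
      by rewrite -[X in (r ^+ 2) `^ X]mulNr sq_powR_half.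
    apply: powRN_anti => //.
    have p2 := pi_ge2 R.
    rewrite w -[leLHS]mul1r; apply: ler_pM => //; [exact: ltW|lra|lra].
- rewrite ler_expR lerN2 /bdecay [leRHS]mulrC ler_wpM2l//.
  by rewrite lef_pV2 ?posrE; [rewrite w; lra|lra|lra].
Qed.

End Estimates.

(** * The nonlocal term *)

Section Potential.
Variables (R : realType) (n : nat) (alpha lambda sigma q : R).
Hypothesis n_gt0 : (0 < n)%N.
Hypothesis alpha_gt0 : 0 < alpha.
Hypothesis lambda_gt0 : 0 < lambda.
Hypothesis sigma_gt0 : 0 < sigma.

Definition potential (u : 'rV[R]_n -> R -> R) (x : 'rV[R]_n) (t : R) : \bar R :=
  strip_integral (fun y s =>
    (powR (heat_kernel (x - y) (t - s)) (alpha / n%:R) * powR (u y s) lambda)%:E).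

Definition bump_const : R := (16 * pi) `^ (- (n%:R / 2)).

(** In order: the constants of the kernel to the power [alpha / n], of [u] to the power [lambda],
    and of the Gaussian integral over [y]; the final 1/2 comes from a time window of length
    [r^2 / 2]. *)
Definition potential_const : R :=
  ((8 * pi) `^ (- (n%:R / 2))) `^ (alpha / n%:R) * bump_const `^ lambda *
  (Num.sqrt (pi / (alpha / n%:R + lambda / 8)) ^+ n / 2).

Let an0 : 0 < alpha / n%:R. Proof. by rewrite divr_gt0// ltr0n. Qed.
Let b0_gt0 : 0 < alpha / n%:R + lambda / 8.
Proof. by rewrite addr_gt0// divr_gt0. Qed.

Lemma bump_const_gt0 : 0 < bump_const.
Proof. by rewrite powR_gt0//; apply: mulr_gt0 => //; exact: pi_gt0. Qed.

Lemma potential_const_gt0 : 0 < potential_const.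
Proof.
apply: mulr_gt0; last first.
  rewrite divr_gt0// exprn_gt0// sqrtr_gt0 divr_gt0// pi_gt0//.
apply: mulr_gt0; last by rewrite powR_gt0// bump_const_gt0.
by rewrite !powR_gt0//; apply: mulr_gt0 => //; exact: pi_gt0.
Qed.

Lemma ler_powR2 (x y e : R) : 0 <= e -> 0 <= x -> x <= y -> x `^ e <= y `^ e.
Proof.
move=> e0 x0 xy; apply: ge0_ler_powR => //; rewrite nnegrE//.
exact: le_trans x0 xy.
Qed.

Variables (a r : R) (u : 'rV[R]_n -> R -> R).
Hypothesis r_gt0 : 0 < r.
Hypothesis a_ge : - r ^+ 2 <= a.
Hypothesis a_le : a + 4 * r ^+ 2 <= 1.
Hypothesis u_ge : forall y s, 0 < s < 1 -> a + r ^+ 2 <= s <= a + 3 * r ^+ 2 ->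
  bump_const * r `^ (- q) * expR (- (sqnorm y / (8 * r ^+ 2))) <= u y s.

Let r_neq0 : r != 0. Proof. by rewrite gt_eqF. Qed.
Let r2 : 0 < r ^+ 2. Proof. by rewrite exprn_gt0. Qed.

(** The past time [s] runs through the first quarter of the mature phase and [t] through its second
    half, so the elapsed time is comparable to [r^2] and the kernel is not degenerate. *)
Let window (s t : R) : a + 2 * r ^+ 2 <= t <= a + 3 * r ^+ 2 ->
  a + r ^+ 2 < s < a + 3 / 2 * r ^+ 2 ->
  [/\ r ^+ 2 / 2 <= t - s <= 2 * r ^+ 2, 0 < s < 1 &
      a + r ^+ 2 <= s <= a + 3 * r ^+ 2].
Proof.
move=> /andP[t1 t2] /andP[s1 s2]; move: a_ge a_le r2 => h1 h2 h3.
by split; apply/andP; split; lra.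
Qed.

(** The power of [r] collects [r^-alpha] from the kernel, [r^(-q lambda)] from [u], [r^n] from the
    integral over [y] and [r^2] from the time window. *)
Lemma potential_lower x t : a + 2 * r ^+ 2 <= t <= a + 3 * r ^+ 2 ->
  ((potential_const * r `^ (n%:R + 2 - alpha - q * lambda) *
    expR (- (alpha / n%:R * (sqnorm x / r ^+ 2))))%:E <= potential u x t)%E.
Proof.
move=> tI.
have nn : n%:R != 0 :> R by rewrite pnatr_eq0 -lt0n.
pose Q : R := (8 * pi) `^ (- (n%:R / 2)).
pose P := bump_const.
have P0 : 0 < P := bump_const_gt0.
have Q0 : 0 < Q by rewrite powR_gt0//; apply: mulr_gt0 => //; exact: pi_gt0.
pose b0 := alpha / n%:R + lambda / 8.
pose b := b0 / r ^+ 2.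
pose c := Q `^ (alpha / n%:R) * r `^ (- alpha) * expR (- (alpha / n%:R * (sqnorm x / r ^+ 2)))
   * (P `^ lambda * r `^ (- (q * lambda))).
have c0 : 0 <= c by rewrite !mulr_ge0 ?powR_ge0 ?expR_ge0.
have b_gt0 : 0 < b by rewrite divr_gt0.
have key := @strip_integral_lower R n (fun y s =>
    (powR (heat_kernel (x - y) (t - s)) (alpha / n%:R) * powR (u y s) lambda)%:E)
  (a + r ^+ 2) (a + 3 / 2 * r ^+ 2) c b.
apply: le_trans (key _ _ _ c0 b_gt0 _ _).
- rewrite lee_fin le_eqVlt; apply/orP; left; apply/eqP.
  have -> : Num.sqrt (pi / b) = Num.sqrt (pi / b0) * r.
    rewrite (_ : pi / b = pi / b0 * r ^+ 2).
      rewrite sqrtrM ?sqrtr_sqr ?ger0_norm ?(ltW r_gt0)//.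
      by rewrite divr_ge0 ?pi_ge0// ltW.
    by rewrite /b; move: (pi : R) => p; field; rewrite !gt_eqF.
  rewrite exprMn /potential_const /c -/b0 -/Q -/P.
  have -> : r `^ (n%:R + 2 - alpha - q * lambda) =
      r ^+ 2 * r ^+ n * r `^ (- alpha) * r `^ (- (q * lambda)).
    rewrite -!powR_mulrn ?(ltW r_gt0)// -!powRD ?r_neq0 ?implybT//.
    by congr (_ `^ _); ring.
  move: (Q `^ _) (P `^ _) (Num.sqrt (pi / b0) ^+ n) (r ^+ n) (r `^ (- alpha))
    (r `^ (- (q * lambda))) (expR _) => A1 A2 A3 A4 A5 A6 A7.
  by field.
- by move: a_ge; lra.
- by move: r2; lra.
- by move: a_le r2; lra.
- by move=> y s; rewrite lee_fin mulr_ge0// powR_ge0.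
- move=> y s sI; rewrite lee_fin; have [w1 w2 w3] := window tI sI.
  have E : c * expR (- (b * sqnorm y)) =
     (Q * r `^ (- n%:R) * expR (- ((sqnorm x + sqnorm y) / r ^+ 2))) `^ (alpha / n%:R) *
     (P * r `^ (- q) * expR (- (sqnorm y / (8 * r ^+ 2)))) `^ lambda.
    rewrite !powRM ?powR_ge0 ?expR_ge0 ?mulr_ge0 ?powR_ge0 ?(ltW P0) ?(ltW Q0)//.
    rewrite -(powRrM r (- n%:R)) -(powRrM r (- q)) !powR_expR /c /b /b0.
    have -> : - n%:R * (alpha / n%:R) = - alpha by field.
    have -> : - q * lambda = - (q * lambda) by ring.
    have -> : alpha / n%:R * - ((sqnorm x + sqnorm y) / r ^+ 2) =
        - (alpha / n%:R * (sqnorm x / r ^+ 2)) - alpha / n%:R * (sqnorm y / r ^+ 2).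
      by field; rewrite nn gt_eqF.
    have -> : - ((alpha / n%:R + lambda / 8) / r ^+ 2 * sqnorm y) =
        - (alpha / n%:R * (sqnorm y / r ^+ 2)) + lambda * - (sqnorm y / (8 * r ^+ 2)).
      by field; rewrite nn gt_eqF.
    rewrite !expRD; move: (Q `^ _) (P `^ _) => Q' P'; ring.
  rewrite E; apply: ler_pM; rewrite ?powR_ge0//.
    apply: ler_powR2; first exact: ltW.
      by rewrite !mulr_ge0 ?powR_ge0 ?expR_ge0.
    exact: heat_kernel_lower.
  apply: ler_powR2; first exact: ltW.
    by rewrite !mulr_ge0 ?powR_ge0 ?expR_ge0.
  exact: u_ge.
Qed.

Lemma reaction_lower x t : a + 2 * r ^+ 2 <= t <= a + 3 * r ^+ 2 ->
  ((potential_const * bump_const `^ sigma *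
    r `^ (n%:R + 2 - alpha - q * lambda - q * sigma) *
    expR (- ((alpha / n%:R + sigma / 8) * (sqnorm x / r ^+ 2))))%:E
  <= potential u x t * (u x t `^ sigma)%:E)%E.
Proof.
move=> tI; have /andP[t1 t2] := tI.
have h1 := potential_lower x tI.
have h2 : bump_const `^ sigma * r `^ (- (q * sigma)) *
    expR (- (sigma / 8 * (sqnorm x / r ^+ 2))) <= u x t `^ sigma.
  have -> : bump_const `^ sigma * r `^ (- (q * sigma)) *
    expR (- (sigma / 8 * (sqnorm x / r ^+ 2))) =
    (bump_const * r `^ (- q) * expR (- (sqnorm x / (8 * r ^+ 2)))) `^ sigma.
    rewrite !powRM ?powR_ge0 ?expR_ge0 ?mulr_ge0 ?powR_ge0//.
    rewrite -(powRrM r) powR_expR mulNr; congr (_ * expR _).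
    by field; rewrite gt_eqF.
  apply: ler_powR2; first exact: ltW.
    by rewrite !mulr_ge0 ?powR_ge0 ?expR_ge0.
  apply: u_ge; apply/andP; split; move: a_ge a_le r2; lra.
have -> : potential_const * bump_const `^ sigma *
    r `^ (n%:R + 2 - alpha - q * lambda - q * sigma) *
    expR (- ((alpha / n%:R + sigma / 8) * (sqnorm x / r ^+ 2))) =
  (potential_const * r `^ (n%:R + 2 - alpha - q * lambda) *
    expR (- (alpha / n%:R * (sqnorm x / r ^+ 2)))) *
  (bump_const `^ sigma * r `^ (- (q * sigma)) *
    expR (- (sigma / 8 * (sqnorm x / r ^+ 2)))).
  rewrite powRD ?r_neq0 ?implybT// mulrDl opprD expRD; ring.
rewrite EFinM; apply: lee_pmul => //; rewrite lee_fin.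
  by rewrite !mulr_ge0 ?powR_ge0 ?expR_ge0// ltW// potential_const_gt0.
by rewrite !mulr_ge0 ?powR_ge0 ?expR_ge0.
Qed.

End Potential.

(** * The solution *)

Section Solution.
Variables (R : realType) (n : nat) (alpha lambda sigma q kappa r0 : R).
Variable phi : R -> R.
Hypothesis n_gt0 : (0 < n)%N.
Hypothesis alpha_gt0 : 0 < alpha.
Hypothesis lambda_gt0 : 0 < lambda.
Hypothesis sigma_gt0 : 0 < sigma.
Hypothesis q_gt0 : 0 < q.
Hypothesis q_ltn : q < n%:R.
Hypothesis kappa_gt0 : 0 < kappa.
Hypothesis kappa_half : kappa ^+ 2 <= 1 / 2.
Hypothesis r0_gt0 : 0 < r0.
Hypothesis r0_half : r0 <= 1 / 2.
Hypothesis phi_cont : {within `]0, 1[, continuous phi}.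

Local Notation rd := (rad kappa r0).
Local Notation st := (start n q kappa r0 phi).
Local Notation ms := (mass n q kappa r0).

Let A k := bamp n (ms k) (st k) (rd k).
Let A' k := bamp' n (ms k) (st k) (rd k).
Let B k := bdecay (st k) (rd k).
Let B' k := bdecay' (st k) (rd k).
Let rd_gt0 k : 0 < rd k. Proof. exact: rad_gt0. Qed.
Let rd2_gt0 k : 0 < rd k ^+ 2. Proof. exact: exprn_gt0. Qed.

Definition bumps : nat -> 'rV[R]_n -> R -> R := gauss A B.
Definition sol : 'rV[R]_n -> R -> R := gauss_sum bumps.

Definition source (k : nat) (x : 'rV[R]_n) (t : R) : R :=
  ms k * (ramp' (btime (st k) (rd k) t) / rd k ^+ 2) * bpeak n (st k) (rd k) t
  * expR (- (bdecay (st k) (rd k) t * sqnorm x)).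

Let dA k (t : R) : is_derive t 1 (A k) (A' k t).
Proof. exact: bamp_is_derive. Qed.
Let dB k (t : R) : is_derive t 1 (B k) (B' k t).
Proof. exact: bdecay_is_derive. Qed.
Let cA' k : continuous (A' k). Proof. exact: bamp'_continuous. Qed.
Let cB' k : continuous (B' k). Proof. exact: bdecay'_continuous. Qed.
Let B_ge0 k t : 0 <= B k t. Proof. exact: bdecay_ge0. Qed.
Let ms_gt0 k : 0 < ms k. Proof. exact: mass_gt0. Qed.
Let cvg_ms : cvgn (series ms).
Proof. by apply: rad_powR_summable => //; rewrite subr_gt0. Qed.

(** From [N] on, all bumps have matured by time [t / 4]. For [s > t / 2] the switch is then constant
    and the width at least [t / 4], so amplitude, decay and their derivatives are bounded in terms
    of [t], up to the factor [ms k]. *)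
Let dom (t : R) : 0 < t -> exists (N : nat) (C : R), \forall s \near t,
  forall k, (N <= k)%N -> [/\ `|A k s| <= C * ms k, `|A' k s| <= C * ms k,
    B k s <= C & `|B' k s| <= C].
Proof.
move=> t0; have t40 : 0 < t / 4 by rewrite divr_gt0.
have [N HN] := start_cvg0 n kappa_gt0 kappa_half r0_gt0 r0_half q_gt0 phi_cont t40.
pose P : R := (pi * t) `^ (- (n%:R / 2)).
have P0 : 0 <= P by exact: powR_ge0.
have n2 : 0 <= n%:R / 2 :> R by rewrite divr_ge0.
have t4 : 0 <= 4 / t by rewrite divr_ge0// ltW.
have c1 : 0 <= P * (n%:R / 2) * (4 / t) by apply: mulr_ge0 => //; exact: mulr_ge0.
have c2 : 0 <= t^-1 by rewrite invr_ge0 ltW.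
have c3 : 0 <= 4 / t ^+ 2 by rewrite divr_ge0// sqr_ge0.
pose C := P + P * (n%:R / 2) * (4 / t) + t^-1 + 4 / t ^+ 2.
exists N, C; near=> s => k Nk.
have st2 : t / 2 < s by near: s; apply: lt_nbhsr; lra.
have hk := HN k Nk; have r2 := rd2_gt0 k; have m0 := ms_gt0 k.
have s1 : st k <= s by lra.
have s2 : st k + rd k ^+ 2 <= s by lra.
have w := bwidthE (rd_gt0 k) s1; have w' := bwidth'E (rd_gt0 k) s1.
have w0 := bwidth_gt0 (st k) (rd_gt0 k) s.
have wt : t / 4 <= bwidth (st k) (rd k) s by rewrite w; lra.
have t2 := btime_ge1 (rd_gt0 k) s2.
have pk0 : 0 <= bpeak n (st k) (rd k) s by apply/ltW/bpeak_gt0.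
have hpk : bpeak n (st k) (rd k) s <= P.
  apply: powRN_anti => //; first by apply: mulr_gt0 => //; exact: pi_gt0.
  rewrite -mulrA mulrCA ler_pM2l ?pi_gt0//; lra.
have hA : A k s = ms k * bpeak n (st k) (rd k) s.
  by rewrite /A /bamp ramp1// mulr1.
have hA0 : 0 <= A k s by rewrite hA mulr_ge0// ltW.
have hAP : A k s <= P * ms k by rewrite hA mulrC ler_wpM2r// ltW.
have iw : (bwidth (st k) (rd k) s)^-1 <= 4 / t.
  by rewrite -[4 / t]invf_div lef_pV2 ?posrE.
have iw0 : 0 <= (bwidth (st k) (rd k) s)^-1 by rewrite invr_ge0 ltW.
have le_C c : c <= C -> c * ms k <= C * ms k by move=> cC; rewrite ler_wpM2r// ltW.
split.
- rewrite ger0_norm// (le_trans hAP)// le_C// /C; lra.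
- have -> : A' k s = - (A k s * (n%:R / 2) * (bwidth (st k) (rd k) s)^-1).
    rewrite /A' /bamp' -/(A k s) ramp'1// w' mul0r mulr0 mul0r add0r mulrN !mul1r.
    by rewrite mulNr.
  rewrite normrN ger0_norm; last by apply: mulr_ge0 => //; exact: mulr_ge0.
  apply: (@le_trans _ _ (P * (n%:R / 2) * (4 / t) * ms k)); last first.
    by apply: le_C; rewrite /C; lra.
  have -> : P * (n%:R / 2) * (4 / t) * ms k = P * ms k * (n%:R / 2) * (4 / t) by ring.
  by apply: ler_pM => //; [exact: mulr_ge0|exact: ler_wpM2r].
- apply: (@le_trans _ _ t^-1); last by rewrite /C; lra.
  by rewrite /B /bdecay lef_pV2 ?posrE//; lra.
- apply: (@le_trans _ _ (4 / t ^+ 2)); last by rewrite /C; lra.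
  rewrite /B' /bdecay' w' normrN mul1r invfM normrM.
  rewrite ger0_norm ?invr_ge0// ger0_norm ?invr_ge0 ?sqr_ge0//.
  have -> : 4 / t ^+ 2 = 4^-1 * (4 / t) ^+ 2 by field; rewrite gt_eqF.
  by rewrite ler_wpM2l ?invr_ge0// -exprVn ler_sqr ?nnegrE.
Unshelve. all: by end_near. Qed.

Lemma sol_C21 : C21 sol.
Proof. exact: (gauss_sum_C21 dA dB cA' cB' B_ge0 cvg_ms dom). Qed.

Lemma bumps_cvg x t : 0 < t -> cvgn (series (fun k => bumps k x t)).
Proof.
by move=> t0; have [] := gauss_sum_cvg B_ge0 cvg_ms dom x t0.
Qed.

Lemma sol_heat x t : 0 < t ->
  dt sol x t - laplacian sol x t = limn (series (fun k => source k x t)).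
Proof.
move=> t0; rewrite (gauss_sum_heat dA dB B_ge0 cvg_ms dom x t0).
congr (limn (series _)); apply/funext => k.
have -> : \sum_(i < n) gauss_dxx A B i i k x t =
    (4 * B k t ^+ 2 * sqnorm x - 2 * n%:R * B k t) * gauss A B k x t.
  rewrite /gauss_dxx -mulr_suml; congr (_ * _).
  rewrite sumrB /sqnorm mulr_sumr; congr (_ - _).
    by apply: eq_bigr => i _; ring.
  under eq_bigr do rewrite eqxx mulr1.
  by rewrite sumr_const card_ord -mulr_natr; ring.
rewrite /gauss_dt /gauss mulrA -mulrBl /source.
by congr (_ * _); exact: bump_heat.
Qed.

Lemma bumps_ge0 k x t : 0 <= bumps k x t.
Proof.
rewrite mulr_ge0 ?expR_ge0// /A /bamp mulr_ge0//.
  by rewrite mulr_ge0 ?ramp_ge0// ltW.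
exact/ltW/bpeak_gt0.
Qed.

Lemma source_ge0 k x t : 0 <= source k x t.
Proof.
rewrite mulr_ge0 ?expR_ge0// mulr_ge0//; last exact/ltW/bpeak_gt0.
by apply: mulr_ge0; [exact: ltW|rewrite divr_ge0 ?ramp'_ge0// ltW].
Qed.

Lemma series_ge_term (f : nat -> R) k :
  (forall j, 0 <= f j) -> cvgn (series f) -> f k <= limn (series f).
Proof.
move=> f0 cf; have nd : nondecreasing_seq (series f).
  by apply/nondecreasing_seqP => j; rewrite seriesSr lerDl.
apply: le_trans (nondecreasing_cvgn_le nd cf k.+1).
by rewrite seriesSr lerDr seriesEnat sumr_ge0.
Qed.

Lemma sol_ge_bumps k x t : 0 < t -> bumps k x t <= sol x t.
Proof.
move=> t0; apply: (@series_ge_term (fun k => bumps k x t)) => //.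
  by move=> j; exact: bumps_ge0.
exact: bumps_cvg.
Qed.

(** Bump 0 starts at [- rad 0 ^+ 2], hence is fully switched on at all positive times. *)
Lemma sol_gt0 x t : 0 < t -> 0 < sol x t.
Proof.
move=> t0; apply: lt_le_trans (sol_ge_bumps 0 x t0).
rewrite mulr_gt0 ?expR_gt0// /A /bamp ramp1 ?mulr1.
  by rewrite mulr_gt0// bpeak_gt0.
by apply: btime_ge1 => //; rewrite /start; lra.
Qed.

Lemma sol_lower k (y : 'rV[R]_n) s : 0 < s < 1 ->
  st k + rd k ^+ 2 <= s <= st k + 3 * rd k ^+ 2 ->
  bump_const R n * rd k `^ (- q) * expR (- (sqnorm y / (8 * rd k ^+ 2))) <= sol y s.
Proof.
move=> /andP[s0 _] sI; apply: le_trans (sol_ge_bumps k y s0).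
exact: bump_lower.
Qed.

Let D0 := alpha / n%:R + sigma / 8.
Let C0 := potential_const n alpha lambda * bump_const R n `^ sigma.
(** The surplus of exponents: in powers of the parent's radius, the reaction exceeds the cost
    [r^(-q-2)] by the factor [r^-delta]. *)
Let delta := q * (lambda + sigma - 1) - (n%:R + 4 - alpha).
(** Three smallness conditions: the child's source decays at least as fast as the parent's reaction;
    each generation gains a factor 1/2; the first radius absorbs all constants, 64 being 16 from the
    source times 4 from [2^-(k+2)]. *)
Hypothesis kappa_D0 : kappa ^+ 2 * (8 * D0) <= 1.
Hypothesis kappa_delta : kappa `^ delta <= 1 / 2.
Hypothesis r0_delta : 64 * r0 `^ delta <= C0 * kappa `^ (q + 2).

Lemma child_source_le k (x : R) : 0 <= x ->
  16 * rd k.+1 `^ (- q - 2) * expR (- (x / (8 * rd k.+1 ^+ 2))) <=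
  2^-1 ^+ k.+2 * (C0 * rd k `^ (n%:R + 2 - alpha - q * lambda - q * sigma) *
    expR (- (D0 * (x / rd k ^+ 2)))).
Proof.
move=> x0; have r := rd_gt0 k; have r2 := rd2_gt0 k.
have k2 : 0 < kappa ^+ 2 by rewrite exprn_gt0.
rewrite [leRHS]mulrA; apply: ler_pM; [|exact: expR_ge0| |].
- by rewrite mulr_ge0// powR_ge0.
- rewrite radS powRM ?(ltW kappa_gt0) ?(ltW r)//.
  have -> : rd k `^ (n%:R + 2 - alpha - q * lambda - q * sigma) =
      rd k `^ (- q - 2) * rd k `^ (- delta).
    rewrite -powRD; last by apply/implyP => _; rewrite gt_eqF.
    by congr (_ `^ _); rewrite /delta; ring.
  have -> : 2^-1 ^+ k.+2 * (C0 * (rd k `^ (- q - 2) * rd k `^ (- delta))) =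
     2^-1 ^+ k.+2 * C0 * rd k `^ (- delta) * rd k `^ (- q - 2) by ring.
  rewrite mulrA ler_wpM2r ?powR_ge0//.
  have rdd : 0 < rd k `^ delta by rewrite powR_gt0.
  have kq : 0 < kappa `^ (q + 2) by rewrite powR_gt0.
  rewrite (_ : - q - 2 = - (q + 2)); last by ring.
  rewrite !powRN ler_pdivrMr// mulrAC ler_pdivlMr//.
  rewrite rad_powR//.
  have h : (kappa `^ delta) ^+ k <= 2^-1 ^+ k.
    by rewrite lerXn2r ?nnegrE ?powR_ge0// -[2^-1]div1r.
  have rr : 0 <= r0 `^ delta by exact: powR_ge0.
  have h1 : 16 * (r0 `^ delta * (kappa `^ delta) ^+ k) <= 16 * r0 `^ delta * 2^-1 ^+ k.
    by rewrite mulrA ler_wpM2l// mulr_ge0.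
  apply: (le_trans h1).
  have e0 : 0 <= 2^-1 ^+ k :> R by rewrite exprn_ge0.
  rewrite (_ : 2^-1 ^+ k.+2 * C0 * kappa `^ (q + 2) =
     (C0 * kappa `^ (q + 2) / 4) * 2^-1 ^+ k); last by rewrite !exprS; field.
  by rewrite ler_wpM2r//; move: r0_delta; lra.
- rewrite ler_expR lerN2 mulrCA ler_wpM2l// ler_pdivrMr//.
  have -> : (8 * rd k.+1 ^+ 2)^-1 * rd k ^+ 2 = 1 / (8 * kappa ^+ 2).
    by rewrite radS; field; rewrite !gt_eqF.
  rewrite ler_pdivlMr; last by move: k2; lra.
  by move: kappa_D0; lra.
Qed.

Local Notation react x t :=
  (potential alpha lambda sol x t * (sol x t `^ sigma)%:E)%E.

Lemma react_ge0 x t : (0 <= react x t)%E.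
Proof.
apply: mule_ge0; last by rewrite lee_fin powR_ge0.
apply: integral_ge0 => s _; apply: Rn_integral_ge0 => y.
by rewrite lee_fin mulr_ge0// powR_ge0.
Qed.

(** A source that is active at a positive time belongs to a child that is not a restart. As the
    squared radius at least halves, its switching interval lies in the window
    [[a + 2 r^2, a + 3 r^2]] of its parent, where [reaction_lower] applies. The weights [2^-(k+1)]
    sum to 1. *)
Lemma source_le k x t : 0 < t < 1 ->
  ((source k x t)%:E <= (2^-1 ^+ k.+1)%:E * react x t)%E.
Proof.
move=> /andP[t0 t1].
have zero : ramp' (btime (st k) (rd k) t) = 0 ->
    ((source k x t)%:E <= (2^-1 ^+ k.+1)%:E * react x t)%E.
  move=> z; rewrite /source z mul0r mulr0 !mul0r; apply: mule_ge0; last exact: react_ge0.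
  by rewrite lee_fin exprn_ge0.
have late : st k + rd k ^+ 2 <= t ->
    ((source k x t)%:E <= (2^-1 ^+ k.+1)%:E * react x t)%E.
  by move=> h; apply/zero/ramp'1/btime_ge1.
case: k zero late => [|k] zero late; first by apply: late; rewrite /start; lra.
have sE := startS n q kappa r0 phi k.
have [rk|rk] := boolP (restart n q kappa r0 phi k); rewrite ?rk ?(negbTE rk) in sE.
  by apply: late; rewrite sE; lra.
have [/late//|tl] := leP (st k.+1 + rd k.+1 ^+ 2) t.
have [h|h] := leP t (st k.+1); first by apply/zero/ramp'0/btime_le0.
have rS := rad_sqS r0 kappa_half k; have r2 := rd2_gt0 k.
have h1 := start_ge n q phi kappa_gt0 kappa_half r0_gt0 k.
have h2 := start_le n q phi kappa_gt0 kappa_half r0_gt0 r0_half k.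
have tI : st k + 2 * rd k ^+ 2 <= t <= st k + 3 * rd k ^+ 2.
  by apply/andP; split; lra.
have hr := @reaction_lower R n alpha lambda sigma q n_gt0 alpha_gt0 lambda_gt0
  sigma_gt0 (st k) (rd k) sol (rd_gt0 k).
have {}hr := hr h1 _ (@sol_lower k) x t tI.
apply: (@le_trans _ _ (2^-1 ^+ k.+2 * (C0 *
    rd k `^ (n%:R + 2 - alpha - q * lambda - q * sigma) *
    expR (- (D0 * (sqnorm x / rd k ^+ 2)))))%:E).
  rewrite lee_fin; apply: le_trans (child_source_le k (sqnorm_ge0 x)).
  exact: bump_source_upper (sqnorm_ge0 x).
rewrite EFinM; apply: lee_wpmul2l; first by rewrite lee_fin exprn_ge0.
apply: hr; lra.
Qed.

(** At a fixed positive time only finitely many sources are nonzero, hence domination by 0 from some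
    index on. *)
Lemma source_cvg x t : 0 < t -> cvgn (series (fun k => source k x t)).
Proof.
move=> t0.
have [N HN] := start_cvg0 n kappa_gt0 kappa_half r0_gt0 r0_half q_gt0 phi_cont t0.
apply: (@dominated_series_cvg _ _ (fun=> 0) N) => [k Nk|].
  rewrite /source ramp'1 ?mul0r ?mulr0 ?mul0r ?normr0//; apply: btime_ge1 => //.
  by have := HN k Nk; have := rd2_gt0 k; lra.
have -> : series (fun=> 0) = (fun=> 0) :> (nat -> R).
  by apply/funext => k; rewrite seriesEnat/= big1.
exact: is_cvg_cst.
Qed.

Lemma sol_heat_bounds x t : 0 < t < 1 ->
  0 <= dt sol x t - laplacian sol x t /\
  ((dt sol x t - laplacian sol x t)%:E <= react x t)%E.
Proof.
move=> tI; have /andP[t0 _] := tI; rewrite sol_heat//.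
have cs : cvgn (series (fun k => source k x t)) by exact: source_cvg.
split.
  apply: (le_trans (source_ge0 0 x t)); apply: series_ge_term cs => k.
  exact: source_ge0.
have := fun k => source_le k x tI; have := react_ge0 x t.
(* An infinite right-hand side needs no argument; a finite value [p] is shared out as the geometric
   series of first term [p / 2] and ratio 1/2. *)
case: (react x t) => [p||]; rewrite ?leey ?leeNy_eq//.
rewrite lee_fin => p0 sp; rewrite lee_fin.
have h12 : `|2^-1 : R| < 1 by rewrite ger0_norm; lra.
have cg := @cvg_geometric_series R (p / 2) 2^-1 h12.
have -> : p = limn (series (geometric (p / 2) 2^-1)).
  by rewrite (cvg_lim _ cg)//; field.
apply: lim_series_le => //; first by apply/cvg_ex; eexists; exact: cg.
move=> k; have := sp k; rewrite -EFinM lee_fin => /le_trans; apply.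
by rewrite /= exprS le_eqVlt; apply/orP; left; apply/eqP; ring.
Qed.

(** * Comparison with [phi] at the origin *)

Lemma bumps_peak k : 0 < st k + rd k ^+ 2 ->
  bumps k 0 (st k + rd k ^+ 2) = peak n q kappa r0 k.
Proof.
move=> t0; have r2 := rd2_gt0 k.
rewrite /bumps /gauss /A /bamp ramp1 ?mulr1; last exact: btime_ge1.
have -> : sqnorm (0 : 'rV[R]_n) = 0.
  by rewrite /sqnorm big1// => i _; rewrite mxE expr0n.
rewrite mulr0 oppr0 expR0 mulr1 /peak /bpeak bwidthE//; last lra.
by congr (_ * powR (_ * _) _); ring.
Qed.

(** At the maturity time of a bump followed by a restart, [peak <= C phi] and [phi^2 < peak] give
    [peak <= C^2], against the growth of the peaks. *)
Lemma sol_not_bounded (C d : R) : 0 < d ->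
  ~ (forall t, 0 < t < d -> `|sol 0 t| <= C * phi t).
Proof.
move=> d0 H.
have [N1 HN1] := start_cvg0 n kappa_gt0 kappa_half r0_gt0 r0_half q_gt0 phi_cont d0.
have [N2 HN2] := peak_unbounded n kappa_gt0 kappa_half r0_gt0 q_gt0 (C ^+ 2).
have [k kN /andP[t0 hphi]] := restart_often n kappa_gt0 kappa_half r0_gt0 r0_half
  q_gt0 phi_cont (maxn N1 N2).
have /HN1 h1 : (N1 <= k)%N by rewrite (leq_trans _ kN)// leq_maxl.
have /HN2 h2 : (N2 <= k)%N by rewrite (leq_trans _ kN)// leq_maxr.
have r2 := rd2_gt0 k.
have := H (st k + rd k ^+ 2); rewrite t0/= (_ : st k + rd k ^+ 2 < d = true); last lra.
move=> /(_ isT); rewrite ger0_norm; last by apply/ltW/sol_gt0.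
move=> h; have := sol_ge_bumps k 0 t0; rewrite bumps_peak// => /le_trans/(_ h) {}h.
have p0 := peak_gt0 n q kappa_gt0 r0_gt0 k.
move: h hphi h2 p0; move: (peak _ _ _ _ _) (phi _) => P f h hphi h2 p0.
have : P ^+ 2 <= (C * f) ^+ 2 by rewrite ler_sqr ?nnegrE ?(ltW p0)// (le_trans (ltW p0)).
rewrite exprMn => hP.
have : C ^+ 2 * f ^+ 2 <= C ^+ 2 * P by rewrite ler_wpM2l ?sqr_ge0// ltW.
move=> hC; have : P * P <= C ^+ 2 * P by rewrite -expr2; exact: le_trans hC.
by rewrite ler_pM2r//; lra.
Qed.

End Solution.

(** * Integrability *)

(* Writing [f k = theta ^ k * (f k / theta ^ k)] bounds the sum by a geometric series
   times the supremum of the second factors; this works for every exponent [lambda > 0]. *)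
Lemma powR_series_le (R : realType) (f : nat -> R) (theta lambda : R) :
  0 < theta < 1 -> 0 < lambda -> (forall k, 0 <= f k) -> cvgn (series f) ->
  ((limn (series f) `^ lambda)%:E <=
   \sum_(k <oo) ((1 - theta) `^ (- lambda) * (f k / theta ^+ k) `^ lambda)%:E)%E.
Proof.
move=> /andP[h0 h1] l0 f0 cf.
have th0 k : 0 < theta ^+ k by rewrite exprn_gt0.
have omt : 0 < 1 - theta by rewrite subr_gt0.
set S := (X in (_ <= X)%E).
have S_ge k : (((1 - theta) `^ (- lambda) * (f k / theta ^+ k) `^ lambda)%:E <= S)%E.
  rewrite /S (nneseriesD1 (n := k))//; last first.
    by move=> j _; rewrite lee_fin mulr_ge0// powR_ge0.
  apply: leeDl; apply: nneseries_ge0 => j _ _.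
  by rewrite lee_fin mulr_ge0// powR_ge0.
have : (0 <= S)%E by apply: nneseries_ge0 => j _ _; rewrite lee_fin mulr_ge0// powR_ge0.
case: S S_ge => [p||]; rewrite ?leey ?leeNy_eq// => hp p0.
rewrite lee_fin in p0; rewrite lee_fin.
have fk k : f k <= geometric ((1 - theta) * p `^ lambda^-1) theta k.
  have := hp k; rewrite lee_fin powRN mulrC ler_pdivrMr ?powR_gt0// => h.
  have g0 : 0 <= f k / theta ^+ k by rewrite divr_ge0// ltW.
  have := @ler_powR2 R _ _ lambda^-1 _ (powR_ge0 _ _) h.
  rewrite -powRrM mulfV ?gt_eqF// powRr1// => /(_ _) h2.
  have {}h2 : f k / theta ^+ k <= (p * (1 - theta) `^ lambda) `^ lambda^-1.
    by apply: h2; rewrite invr_ge0 ltW.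
  rewrite /= -ler_pdivrMr// (le_trans h2)// powRM ?powR_ge0//.
  by rewrite -powRrM mulfV ?gt_eqF// powRr1 ?(ltW omt)// mulrC.
have nth : `|theta| < 1 by rewrite ger0_norm// ltW.
have cg := @cvg_geometric_series R ((1 - theta) * p `^ lambda^-1) theta nth.
have lg : limn (series f) <= p `^ lambda^-1.
  have -> : p `^ lambda^-1 = limn (series (geometric ((1 - theta) * p `^ lambda^-1) theta)).
    rewrite (cvg_lim _ cg)// mulrAC mulfV ?mul1r// gt_eqF//.
  by apply: lim_series_le => //; apply/cvg_ex; eexists; exact: cg.
have L0 : 0 <= limn (series f) by apply: le_trans (series_ge_term 0 f0 cf).
apply: (le_trans (ler_powR2 (ltW l0) L0 lg)).
by rewrite -powRrM mulVf ?gt_eqF// powRr1.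
Qed.

Lemma powR_inv (R : realType) (x e : R) : 0 <= x -> (x^-1) `^ e = (x `^ e)^-1.
Proof. by move=> x0; rewrite -(powR_inv1 x0) powRAC powR_inv1 ?powR_ge0. Qed.

Lemma nneseries_geometric_lty (R : realType) (a z : R) : 0 <= a -> 0 <= z < 1 ->
  (\sum_(k <oo) (a * z ^+ k)%:E < +oo)%E.
Proof.
move=> a0 /andP[z0 z1].
have nz : `|z| < 1 by rewrite ger0_norm.
have cg := @cvg_geometric_series R a z nz.
apply: (@le_lt_trans _ _ (a * (1 - z)^-1)%:E); last exact: ltry.
apply: lime_le.
  by apply: is_cvg_nneseries => k _ _; rewrite lee_fin mulr_ge0// exprn_ge0.
near=> N; rewrite sumEFin lee_fin.
have nd : nondecreasing_seq (series (geometric a z)).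
  by apply/nondecreasing_seqP => j; rewrite seriesSr lerDl mulr_ge0// exprn_ge0.
have cgc : cvgn (series (geometric a z)) by apply/cvg_ex; eexists; exact: cg.
by have := nondecreasing_cvgn_le nd cgc N; rewrite (cvg_lim _ cg)// seriesEnat.
Unshelve. all: by end_near. Qed.

Section Integrability.
Variables (R : realType) (n : nat) (lambda q kappa r0 : R) (phi : R -> R).
Hypothesis lambda_gt0 : 0 < lambda.
Hypothesis q_gt0 : 0 < q.
Hypothesis q_ltn : q < n%:R.
Hypothesis kappa_gt0 : 0 < kappa.
Hypothesis kappa_half : kappa ^+ 2 <= 1 / 2.
Hypothesis r0_gt0 : 0 < r0.
Hypothesis r0_half : r0 <= 1 / 2.
Hypothesis phi_cont : {within `]0, 1[, continuous phi}.

Local Notation rd := (rad kappa r0).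
Local Notation st := (start n q kappa r0 phi).
Local Notation u := (@sol R n q kappa r0 phi).
Local Notation mu := (@lebesgue_measure R).

(** A margin in the powers of the radius. The first bound leaves a nonnegative power of [r] to be
    traded for width, the second makes the exponent [e] of the time integral larger than -1; the
    factor [r^eta] itself provides summability over the bumps. *)
Variable eta : R.
Hypothesis eta_gt0 : 0 < eta.
Hypothesis eta_le1 : eta <= (n%:R - q) * lambda.
Hypothesis eta_lt2 : eta < n%:R + 2 - q * lambda.

Let e := (n%:R - q * lambda - eta) / 2.
Let e_gt : -1 < e. Proof. by rewrite /e; move: eta_lt2; lra. Qed.
(** Chosen so that [theta]^ lambda[is]kappa [^ (eta / 2)]: the splitting of the series spends half
    of the margin and leaves the other half for convergence. *)
Let theta := kappa `^ (eta / (2 * lambda)).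
Let K0 := (1 - theta) `^ (- lambda) * ((4 * pi) `^ (- (n%:R / 2)) `^ lambda *
  Num.sqrt (4 * pi / lambda) ^+ n * r0 `^ eta).

Let l2 : 0 < 2 * lambda. Proof. exact: mulr_gt0. Qed.
Let k1 : kappa < 1. Proof. exact: kappa_lt1. Qed.
Let theta01 : 0 < theta < 1.
Proof. by rewrite powR_gt0// powR_lt1// divr_gt0. Qed.
Let theta_gt0 : 0 < theta. Proof. by have /andP[] := theta01. Qed.

Let K0_ge0 : 0 <= K0.
Proof.
apply: mulr_ge0; first exact: powR_ge0.
apply: mulr_ge0; last exact: powR_ge0.
by apply: mulr_ge0; [exact: powR_ge0|rewrite exprn_ge0// sqrtr_ge0].
Qed.

Let H k (s : R) : R := K0 * (kappa `^ (eta / 2)) ^+ k *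
  (if st k < s then (s - st k + rd k ^+ 2) `^ e else 0).

(** Up to constants, the left side is the integral of the [lambda]-th power of a Gaussian of mass
    [r^(n-q)] and width [w]. Since [r^2 <= w], the power of [r] beyond [r^eta] is at most half that
    power of [w]. *)
Lemma mass_width_le (r w : R) : 0 < r -> r ^+ 2 <= w ->
  r `^ ((n%:R - q) * lambda) * w `^ (- (n%:R / 2 * lambda)) * w `^ (n%:R / 2) <=
  r `^ eta * w `^ e.
Proof.
move=> r_gt0 rw; have w0 : 0 < w by apply: lt_le_trans rw; rewrite exprn_gt0.
have wn : w != 0 by rewrite gt_eqF.
have rn : r != 0 by rewrite gt_eqF.
have -> : r `^ ((n%:R - q) * lambda) = r `^ eta * r `^ ((n%:R - q) * lambda - eta).
  by rewrite -powRD ?rn ?implybT//; congr (_ `^ _); ring.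
have -> : w `^ e = w `^ (((n%:R - q) * lambda - eta) / 2) *
    (w `^ (- (n%:R / 2 * lambda)) * w `^ (n%:R / 2)).
  by rewrite -!powRD ?wn ?implybT//; congr (_ `^ _); rewrite /e; field.
rewrite -!mulrA ler_wpM2l ?powR_ge0// ler_wpM2r ?mulr_ge0 ?powR_ge0//.
rewrite -(sq_powR_half _ r_gt0); apply: ler_powR2 => //; last exact: sqr_ge0.
by rewrite divr_ge0// subr_ge0.
Qed.

Lemma bump_power_le k s : 0 < s ->
  (1 - theta) `^ (- lambda) *
  (bamp n (mass n q kappa r0 k) (st k) (rd k) s / theta ^+ k) `^ lambda *
    Num.sqrt (pi / (lambda * bdecay (st k) (rd k) s)) ^+ n <= H k s.
Proof.
move=> s0; have r := rad_gt0 kappa_gt0 r0_gt0 k.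
have r2 : 0 < rd k ^+ 2 by rewrite exprn_gt0.
rewrite /H; case: ltP => [ss|ss]; last first.
  rewrite /bamp ramp0 ?mulr0 ?mul0r; last exact: btime_le0.
  by rewrite powR0 ?gt_eqF// mulr0 mul0r.
have p0 := pi_gt0 R.
have w := bwidthE r (ltW ss); have w0 := bwidth_gt0 (st k) r s.
set W := bwidth _ _ _ in w w0; rewrite -w.
have hth : (theta ^+ k) `^ lambda = (kappa `^ (eta / 2)) ^+ k.
  rewrite powR_exprn ?(ltW theta_gt0)//; congr (_ ^+ k).
  rewrite /theta -powRrM; congr (_ `^ _).
  by field; rewrite gt_eqF.
have hS : Num.sqrt (pi / (lambda * bdecay (st k) (rd k) s)) =
    Num.sqrt (4 * pi / lambda) * W `^ (1 / 2).
  rewrite (_ : pi / _ = 4 * pi / lambda * W).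
    rewrite sqrtrM; last by rewrite divr_ge0 ?mulr_ge0 ?ltW.
    by rewrite div1r powR12_sqrt// ltW.
  rewrite /bdecay -/W; move: (pi : R) => p; field.
  by rewrite !gt_eqF.
rewrite hS exprMn -[X in _ * (_ * X)]powR_mulrn ?powR_ge0// -powRrM.
have -> : 1 / 2 * n%:R = n%:R / 2 :> R by field.
have hA : (bamp n (mass n q kappa r0 k) (st k) (rd k) s / theta ^+ k) `^ lambda <=
   rd k `^ ((n%:R - q) * lambda) * ((4 * pi) `^ (- (n%:R / 2)) `^ lambda *
     W `^ (- (n%:R / 2 * lambda))) / (kappa `^ (eta / 2)) ^+ k.
  have tk : 0 < theta ^+ k by rewrite exprn_gt0.
  have -> : rd k `^ ((n%:R - q) * lambda) * ((4 * pi) `^ (- (n%:R / 2)) `^ lambda *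
     W `^ (- (n%:R / 2 * lambda))) / (kappa `^ (eta / 2)) ^+ k =
     (mass n q kappa r0 k * bpeak n (st k) (rd k) s / theta ^+ k) `^ lambda.
    have m0 : 0 <= mass n q kappa r0 k by exact: powR_ge0.
    have b0 : 0 <= bpeak n (st k) (rd k) s by exact: powR_ge0.
    have it : 0 <= (theta ^+ k)^-1 by rewrite invr_ge0 ltW.
    have p40 : 0 <= 4 * pi :> R by apply/ltW/mulr_gt0.
    rewrite (powRM _ (mulr_ge0 m0 b0) it) (powRM _ m0 b0) (powR_inv _ (ltW tk)) hth.
    congr (_ * _ / _); first by rewrite /mass -powRrM.
    rewrite /bpeak -/W (powRM _ p40 (ltW w0)) (powRM _ (powR_ge0 _ _) (powR_ge0 _ _)).
    by rewrite -(powRrM W) mulNr.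
  apply: ler_powR2; first exact: ltW.
    rewrite divr_ge0 ?(ltW tk)// /bamp; apply: mulr_ge0; last exact: powR_ge0.
    by apply: mulr_ge0; [exact: powR_ge0|exact: ramp_ge0].
  rewrite ler_pM2r ?invr_gt0// /bamp ler_wpM2r ?powR_ge0//.
  by rewrite ler_piMr ?powR_ge0// ramp_le1.
have kk : 0 < (kappa `^ (eta / 2)) ^+ k by rewrite exprn_gt0// powR_gt0.
have mw := mass_width_le r (w := W).
have {}mw : rd k `^ ((n%:R - q) * lambda) * W `^ (- (n%:R / 2 * lambda)) * W `^ (n%:R / 2)
   <= r0 `^ eta * (kappa `^ (eta / 2)) ^+ k * (kappa `^ (eta / 2)) ^+ k * W `^ e.
  apply: (le_trans (mw _)); first by rewrite w; lra.
  rewrite (rad_powR kappa_gt0 r0_gt0).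
  have -> : kappa `^ eta = kappa `^ (eta / 2) * kappa `^ (eta / 2).
    rewrite -powRD; last by apply/implyP => _; rewrite gt_eqF.
    by congr (_ `^ _); field.
  by rewrite exprMn mulrA.
apply: (@le_trans _ _ ((1 - theta) `^ (- lambda) *
   (rd k `^ ((n%:R - q) * lambda) * ((4 * pi) `^ (- (n%:R / 2)) `^ lambda *
     W `^ (- (n%:R / 2 * lambda))) / (kappa `^ (eta / 2)) ^+ k) *
   (Num.sqrt (4 * pi / lambda) ^+ n * W `^ (n%:R / 2)))).
  rewrite ler_wpM2r//; last by rewrite ler_wpM2l ?powR_ge0.
  by rewrite mulr_ge0 ?powR_ge0// exprn_ge0// sqrtr_ge0.
rewrite /K0.
set X := (1 - theta) `^ (- lambda); set Y := (4 * pi) `^ _ `^ lambda.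
set Z := Num.sqrt _ ^+ n; move: kk mw.
have X0 : 0 <= X by exact: powR_ge0.
have Y0 : 0 <= Y by exact: powR_ge0.
have Z0 : 0 <= Z by rewrite exprn_ge0// sqrtr_ge0.
move: X Y Z X0 Y0 Z0; move: (rd k `^ _) (W `^ (- _)) (W `^ (n%:R / 2)) (W `^ e).
move: (r0 `^ eta) (_ ^+ k) => r' kp a1 a2 a3 a4 X Y Z X0 Y0 Z0 kk mw.
have -> : X * (a1 * (Y * a2) / kp) * (Z * a3) = X * Y * Z * (a1 * a2 * a3 / kp).
  by field; rewrite gt_eqF.
have -> : X * (Y * Z * r') * kp * a4 = X * Y * Z * (r' * kp * a4) by ring.
apply: ler_wpM2l; first by rewrite !mulr_ge0.
by rewrite ler_pdivrMr//; apply: (le_trans mw); rewrite le_eqVlt; apply/orP; left;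
  apply/eqP; ring.
Qed.

Lemma H_ge0 k s : 0 <= H k s.
Proof.
apply: mulr_ge0; last by case: ifP => // _; exact: powR_ge0.
by apply: mulr_ge0 => //; rewrite exprn_ge0// powR_ge0.
Qed.

(** The power of the sum is bounded by a weighted sum of powers; a power of a Gaussian is again a
    Gaussian, with decay multiplied by [lambda], so the integral is explicit. *)
Lemma sol_power_integral_le s : 0 < s ->
  (Rn_integral (fun y => (u y s `^ lambda)%:E) <= \sum_(k <oo) (H k s)%:E)%E.
Proof.
move=> s0.
pose c k := (1 - theta) `^ (- lambda) *
  (bamp n (mass n q kappa r0 k) (st k) (rd k) s / theta ^+ k) `^ lambda.
pose b k := lambda * bdecay (st k) (rd k) s.
have c0 k : 0 <= c k by rewrite mulr_ge0 ?powR_ge0.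
have b0 k : 0 < b k.
  have r := rad_gt0 kappa_gt0 r0_gt0 k.
  rewrite mulr_gt0// /bdecay invr_gt0; apply: mulr_gt0 => //; exact: bwidth_gt0.
apply: (@le_trans _ _ (\sum_(k <oo) (c k * Num.sqrt (pi / b k) ^+ n)%:E)%E); last first.
  by apply: lee_nneseries => k _; rewrite lee_fin; [rewrite mulr_ge0// exprn_ge0// sqrtr_ge0|
    exact: bump_power_le].
rewrite -Rn_integral_gaussian_series//; apply: Rn_integral_mono => y.
rewrite lee_fin powR_ge0/=.
have := @powR_series_le R (fun k => bumps q kappa r0 phi k y s) theta lambda
  theta01 lambda_gt0.
move=> /(_ (fun k => bumps_ge0 q phi kappa_gt0 r0_gt0 k y s)).
move=> /(_ (bumps_cvg q_gt0 q_ltn kappa_gt0 kappa_half r0_gt0 r0_half phi_cont s0)) hle.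
apply: (le_trans hle) => //.
apply: lee_nneseries => k _; rewrite lee_fin; first by rewrite mulr_ge0 ?powR_ge0.
have a0 : 0 <= bamp n (mass n q kappa r0 k) (st k) (rd k) s / theta ^+ k.
  rewrite divr_ge0 ?exprn_ge0 ?(ltW theta_gt0)// /bamp; apply: mulr_ge0; last exact: powR_ge0.
  by apply: mulr_ge0; [exact: powR_ge0|exact: ramp_ge0].
have -> : bumps q kappa r0 phi k y s / theta ^+ k =
    bamp n (mass n q kappa r0 k) (st k) (rd k) s / theta ^+ k *
    expR (- (bdecay (st k) (rd k) s * sqnorm y)) by rewrite /bumps /gauss mulrAC.
by rewrite (powRM _ a0 (expR_ge0 _)) powR_expR mulrN mulrA /b mulrA.
Qed.

Lemma H_measurable k : measurable_fun setT (fun s => (H k s)%:E).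
Proof.
apply/measurable_EFinP; apply: measurable_funM => //.
apply: measurable_fun_ifT => //.
  by apply: measurable_fun_ltr => //.
apply: (measurableT_comp (measurable_powR _)).
by apply: measurable_funD => //; apply: measurable_funB.
Qed.

Lemma sol_Llambda : (strip_integral (fun y s => (u y s `^ lambda)%:E) < +oo)%E.
Proof.
rewrite /strip_integral.
apply: (@le_lt_trans _ _ (\int[mu]_(s in `]0%R, 1%R[) \sum_(k <oo) (H k s)%:E)%E).
  apply: integral_mono => //.
    by move=> s _; apply: nneseries_ge0 => k _ _; rewrite lee_fin H_ge0.
  move=> s /=; rewrite in_itv/= => /andP[s0 _]; apply/andP; split.
    by apply: Rn_integral_ge0 => y; rewrite lee_fin powR_ge0.
  exact: sol_power_integral_le.
rewrite integral_nneseries//; last 2 first.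
- by move=> k; apply: measurable_funS (H_measurable k).
- by move=> k s _; rewrite lee_fin H_ge0.
(* The base [1 - start k + rad k ^+ 2] is at most [1 + 2 * rad k ^+ 2], hence below 3 uniformly in
   [k]. *)
pose K1 := K0 * (3 `^ (e + 1) / (e + 1)).
have e1 : 0 < e + 1 by move: e_gt; lra.
have K1_ge0 : 0 <= K1.
  by apply: mulr_ge0 => //; rewrite divr_ge0 ?powR_ge0// ltW.
apply: (@le_lt_trans _ _ (\sum_(k <oo) (K1 * (kappa `^ (eta / 2)) ^+ k)%:E)%E); last first.
  apply: nneseries_geometric_lty => //; rewrite powR_ge0/=.
  by rewrite powR_lt1// divr_gt0.
apply: lee_nneseries => [k _ _|k _].
  by apply: integral_ge0 => s _; rewrite lee_fin H_ge0.
have r2 : 0 < rd k ^+ 2 by rewrite exprn_gt0// rad_gt0.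
have h1 := start_ge n q phi kappa_gt0 kappa_half r0_gt0 k.
have h2 := start_le n q phi kappa_gt0 kappa_half r0_gt0 r0_half k.
have kk : 0 <= (kappa `^ (eta / 2)) ^+ k by rewrite exprn_ge0// powR_ge0.
have mono : K0 * (kappa `^ (eta / 2)) ^+ k >= 0 by rewrite mulr_ge0.
rewrite /H; under eq_integral do rewrite EFinM.
rewrite ge0_integralZl_EFin//; last 2 first.
- by move=> s _; rewrite lee_fin; case: ifP => // _; exact: powR_ge0.
- apply: measurable_funTS; apply/measurable_EFinP; apply: measurable_fun_ifT => //.
    by apply: measurable_fun_ltr => //.
  apply: (measurableT_comp (measurable_powR _)).
  by apply: measurable_funD => //; apply: measurable_funB.
have st1 : st k < 1 by lra.
apply: (@le_trans _ _ ((K0 * (kappa `^ (eta / 2)) ^+ k)%:E *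
    ((1 - st k + rd k ^+ 2) `^ (e + 1) / (e + 1))%:E)%E).
  by apply: lee_wpmul2l; [rewrite lee_fin|exact: integral_power_shift].
rewrite -EFinM lee_fin /K1 mulrAC ler_wpM2r// ler_wpM2l//.
rewrite ler_wpM2r ?invr_ge0 ?(ltW e1)//; apply: ler_powR2; [exact: ltW|lra|].
have := rad_sq_le kappa_gt0 kappa_half r0_gt0 (leq0n k).
have : rd 0 ^+ 2 <= (1 / 2) ^+ 2.
  have r00 := rad_gt0 kappa_gt0 r0_gt0 0.
  by rewrite ler_sqr ?nnegrE ?(ltW r00)// /rad expr0 mulr1.
by rewrite (_ : (1 / 2) ^+ 2 = 1 / 4 :> R); [lra|field].
Qed.

End Integrability.

(** * Choice of the parameters *)

(** The best candidate is the smaller of [n] and [(n + 2) / lambda]; the two branches of [G_alpha]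
    are the two cases, and in each [sigma > G_alpha] amounts to the last inequality at that
    endpoint. *)
Lemma exists_exponent (R : realType) (n : nat) (alpha lambda sigma : R) :
  (0 < n)%N -> 0 < alpha < n%:R + 2 -> 0 < lambda ->
  G_alpha n alpha lambda < sigma ->
  0 < sigma /\ exists q, [/\ 0 < q, q < n%:R, q * lambda < n%:R + 2 &
    0 < q * (lambda + sigma - 1) - (n%:R + 4 - alpha)].
Proof.
move=> n0 /andP[a0 a1] l0 Gs; have nR : 0 < n%:R :> R by rewrite ltr0n.
have n2 : 0 < n%:R + 2 :> R by lra.
suff [s0 [Q [Q0 Qn Ql Qs]]] : 0 < sigma /\ exists Q, [/\ 0 < Q, Q <= n%:R,
    Q * lambda <= n%:R + 2 & n%:R + 4 - alpha < Q * (lambda + sigma - 1)].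
  split => //; pose s := lambda + sigma - 1.
  have s_gt0 : 0 < s by rewrite -(pmulr_rgt0 _ Q0) /s; lra.
  (* The last inequality is an equality at [p], so the midpoint of [p] and the endpoint [Q] still
     satisfies it and makes the other bounds strict. *)
  pose p := (n%:R + 4 - alpha) / s.
  have p0 : 0 < p by rewrite divr_gt0//; lra.
  have ps : p * s = n%:R + 4 - alpha by rewrite divfK// gt_eqF.
  have pQ : p < Q by rewrite ltr_pdivrMr.
  exists ((p + Q) / 2); split; [lra|lra| |].
    by apply: lt_le_trans Ql; rewrite ltr_pM2r//; lra.
  by rewrite -/s subr_gt0 -ps ltr_pM2r//; lra.
move: Gs; rewrite /G_alpha; case: (ltP lambda) => hl Gs.
  have hl' : lambda * n%:R < n%:R + 2 by move: hl; rewrite ltr_pdivlMr.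
  have Gs' : 2 * (n%:R + 2) - alpha < (sigma + lambda) * n%:R.
    by rewrite -ltr_pdivrMr//; lra.
  split; last by exists n%:R; split => //; [rewrite mulrC; exact: ltW|lra].
  rewrite -(pmulr_lgt0 _ nR); lra.
move: Gs; rewrite gt_max => /andP[s0 Gs]; split => //.
have hl' : n%:R + 2 <= lambda * n%:R by move: hl; rewrite ler_pdivrMr.
exists ((n%:R + 2) / lambda); split.
- by rewrite divr_gt0.
- by rewrite ler_pdivrMr// mulrC.
- by rewrite divfK ?gt_eqF.
- rewrite mulrAC ltr_pdivlMr//.
  have : (1 - (alpha - 2) / (n%:R + 2) * lambda) * (n%:R + 2) < sigma * (n%:R + 2).
    by rewrite ltr_pM2r.
  have -> : (1 - (alpha - 2) / (n%:R + 2) * lambda) * (n%:R + 2) =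
      n%:R + 2 - (alpha - 2) * lambda by field; rewrite gt_eqF.
  lra.
Qed.

Lemma powR_inv_le (R : realType) (x c d : R) : 0 < d -> 0 <= x -> 0 <= c ->
  x <= c `^ d^-1 -> x `^ d <= c.
Proof.
move=> d0 x0 c0 /(ler_powR2 (ltW d0) x0)/le_trans; apply.
by rewrite -powRrM mulVf ?powRr1// gt_eqF.
Qed.

Unset Implicit Arguments.

Theorem theorem1p3 (R : realType) (n : nat) (alpha lambda sigma : R)
    (phi : R -> R) :
  (0 < n)%N ->
  0 < alpha < n%:R + 2 ->
  0 < lambda ->
  G_alpha n alpha lambda < sigma ->
  (forall t, 0 < t < 1 -> 0 < phi t) ->
  {within `]0, 1[, continuous phi} ->
  phi t @[t --> 0^'+] --> +oo ->
  exists u : 'rV[R]_n -> R -> R,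
    [/\ forall x t, 0 < t < 1 -> 0 < u x t,
        C21 u,
        (strip_integral (fun y s => (powR (u y s) lambda)%:E) < +oo)%E,
        forall x t, 0 < t < 1 ->
          0 <= dt u x t - laplacian u x t /\
          ((dt u x t - laplacian u x t)%:E <=
             strip_integral (fun y s =>
               (powR (heat_kernel (x - y) (t - s)) (alpha / n%:R)
                * powR (u y s) lambda)%:E)
             * (powR (u x t) sigma)%:E)%E &
        ~ (exists C : R, exists2 delta : R, 0 < delta &
             forall t, 0 < t < delta -> `|u 0 t| <= C * phi t)].
Proof.
move=> n_gt0 alphaI lambda_gt0 Gs _ phi_cont _.
have [sigma_gt0 [q [q_gt0 q_ltn q_lambda delta_gt0]]] :=
  exists_exponent n_gt0 alphaI lambda_gt0 Gs.
have /andP[alpha_gt0 _] := alphaI.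
set delta := _ - _ in delta_gt0.
have nR : 0 < n%:R :> R by rewrite ltr0n.
pose D0 : R := alpha / n%:R + sigma / 8.
have D0_gt0 : 0 < D0 by rewrite addr_gt0// divr_gt0.
pose C0 : R := potential_const n alpha lambda * bump_const R n `^ sigma.
have C0_gt0 : 0 < C0.
  apply: mulr_gt0; first exact: potential_const_gt0.
  by rewrite powR_gt0// bump_const_gt0.
pose kappa : R := Num.min (1 / 2) (Num.min (1 + 8 * D0)^-1 ((1 / 2) `^ delta^-1)).
have D1 : 0 < 1 + 8 * D0 by lra.
have kappa_gt0 : 0 < kappa.
  by rewrite !lt_min powR_gt0 ?invr_gt0 ?D1 ?andbT//; lra.
have [kh kD kd] : [/\ kappa <= 1 / 2, kappa <= (1 + 8 * D0)^-1 &
    kappa <= (1 / 2) `^ delta^-1].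
  by split; rewrite /kappa !ge_min lexx ?orbT.
have kk : kappa ^+ 2 <= kappa / 2.
  by rewrite expr2 ler_pM2l//; lra.
have kappa_half : kappa ^+ 2 <= 1 / 2 by lra.
have kappa_D0 : kappa ^+ 2 * (8 * D0) <= 1.
  have h : kappa * (1 + 8 * D0) <= 1 by rewrite -ler_pdivlMr// div1r.
  have : kappa ^+ 2 * (8 * D0) <= kappa / 2 * (8 * D0) by rewrite ler_wpM2r//; lra.
  have : 0 <= kappa * (8 * D0) by rewrite mulr_ge0 ?(ltW kappa_gt0)//; lra.
  lra.
have kappa_delta : kappa `^ delta <= 1 / 2.
  by apply: powR_inv_le => //; exact: ltW.
pose c : R := C0 * kappa `^ (q + 2) / 64.
have c_gt0 : 0 < c.
  by rewrite divr_gt0// mulr_gt0// powR_gt0.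
pose r0 : R := Num.min (1 / 2) (c `^ delta^-1).
have r0_gt0 : 0 < r0 by rewrite lt_min powR_gt0// andbT; lra.
have r0_half : r0 <= 1 / 2 by rewrite ge_min lexx.
have r0_delta : 64 * r0 `^ delta <= C0 * kappa `^ (q + 2).
  have : r0 `^ delta <= c.
    apply: powR_inv_le => //; [exact: ltW|exact: ltW|].
    by rewrite ge_min lexx orbT.
  by rewrite /c; lra.
(* The half turns the positive gap [n + 2 - q lambda] into a strict upper bound for [eta]. *)
pose eta : R := Num.min ((n%:R - q) * lambda) ((n%:R + 2 - q * lambda) / 2).
have eta_gt0 : 0 < eta.
  by rewrite lt_min mulr_gt0 ?subr_gt0// divr_gt0// subr_gt0.
have eta_le1 : eta <= (n%:R - q) * lambda by rewrite ge_min lexx.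
have eta_lt2 : eta < n%:R + 2 - q * lambda.
  apply: (@le_lt_trans _ _ ((n%:R + 2 - q * lambda) / 2)); last lra.
  by rewrite ge_min lexx orbT.
exists (@sol R n q kappa r0 phi); split.
- by move=> x t /andP[t0 _]; exact: sol_gt0.
- exact: sol_C21.
- exact: (sol_Llambda lambda_gt0 q_gt0 q_ltn kappa_gt0 kappa_half r0_gt0 r0_half
    phi_cont eta_gt0 eta_le1 eta_lt2).
- by move=> x t tI; exact: sol_heat_bounds.
- move=> [C [d d0 H]].
  exact: (sol_not_bounded q_gt0 q_ltn kappa_gt0 kappa_half r0_gt0 r0_half
    phi_cont d0 H).
Qed.
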